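(* Let $\Omega\subset\mathbb{R}^n$ be a bounded Lipschitz domain, let $L$ be a Tonelli Lagrangian, let $g:\partial\Omega\to\mathbb{R}$ satisfy $g(x)-g(y)\leq\Phi^{\Omega}_L(y,x)$ for all $x,y\in\partial\Omega$, and assume $c_{\Omega}(L)<0$. Let $u(x)=\inf_{y\in\partial\Omega}\{g(y)+\Phi^{\Omega}_L(y,x)\}$, $x\in\overline{\Omega}$. For any $\rho>0$, with $\Omega_\rho=\{x\in\Omega: d_{\partial\Omega}(x)\geq\rho\}$, there is a constant $\bar C>0$, independent of $x$ and $z$, such that for any $x\in\Omega_\rho$ and any $z\in\mathbb{R}^n$ with $|z|<\frac\rho8$, $$u(x+z)+u(x-z)-2u(x)\leq\frac{\bar C}{\rho}|z|^2.$$
   Context: A Tonelli Lagrangian is a $C^2$ function $L:\mathbb{R}^n\times\mathbb{R}^n\to\mathbb{R}$ such that $\frac{\partial^2L}{\partial v^2}(x,v)$ is positive definite for all $(x,v)$, and there exist nondecreasing superlinear functions $\theta_1,\theta_2:[0,+\infty)\to[0,+\infty)$ (superlinear means $\theta(r)/r\to+\infty$ as $r\to+\infty$) and $c_0>0$ with $\theta_2(|v|)\geq L(x,v)\geq\theta_1(|v|)-c_0$ for all $(x,v)$. A Lipschitz domain is a domain whose boundary is locally the graph of a Lipschitz function. For $x,y\in\overline{\Omega}$ and $s<t$, $\Gamma^{s,t}_{x,y}(\overline{\Omega})$ is the set of $\xi\in W^{1,1}([s,t];\mathbb{R}^n)$ with $\xi(\tau)\in\overline\Omega$ for all $\tau\in[s,t]$,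 $\xi(s)=x$, $\xi(t)=y$. For $t>0$, $$A^{\Omega}_t(x,y)=\inf_{\xi\in\Gamma^{0,t}_{x,y}(\overline{\Omega})}\int_0^tL(\xi,\dot\xi)\,ds,\quad \Phi^{\Omega}_L(x,y)=\inf_{t>0}A^{\Omega}_t(x,y),\quad c_{\Omega}(L)=-\inf_{t>0,\,x\in\overline{\Omega}}\tfrac1tA^{\Omega}_t(x,x).$$ $d_{\partial\Omega}$ is the Euclidean distance to $\partial\Omega$. *)

(* Defs.v *)
From HB Require Import structures.
From mathcomp Require Import all_boot all_order all_algebra.
From mathcomp Require Import all_classical all_reals all_analysis.
Set Implicit Arguments.
Unset Strict Implicit.
Unset Printing Implicit Defensive.
Import Order.TTheory GRing.Theory Num.Theory.
Import numFieldNormedType.Exports.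
Local Open Scope classical_set_scope.
Local Open Scope ring_scope.

(** * Euclidean geometry *)

(* The library norm on row vectors is the sup norm.  It induces the Euclidean
   topology, so it is only replaced where the value of a norm matters. *)
Definition enorm (R : realType) (n : nat) (v : 'rV[R]_n) : R :=
  Num.sqrt (\sum_(i < n) v 0 i ^+ 2).

Definition boundary (R : realType) (n : nat) (A : set 'rV[R]_n) :
    set 'rV[R]_n :=
  closure A `\` interior A.

(* Meaningful when the boundary is not empty, which is the case for bounded
   nonempty sets in positive dimension. *)
Definition dist_boundary (R : realType) (n : nat) (Omega : set 'rV[R]_n)
    (x : 'rV[R]_n) : R :=
  inf [set enorm (x - y) | y in boundary Omega].

Definition inner_region (R : realType) (n : nat) (Omega : set 'rV[R]_n)
    (rho : R) : set 'rV[R]_n :=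
  [set x | Omega x /\ rho <= dist_boundary Omega x].

Definition domain (R : realType) (n : nat) (A : set 'rV[R]_n) : Prop :=
  [/\ A !=set0, open A & connected A].

(* Near each boundary point p there are orthonormal coordinates (the
   coordinates of y being the entries of y *m Q) in which the boundary is the
   graph of a Lipschitz function expressing the first coordinate in terms of
   the n others. *)
Definition lipschitz_boundary (R : realType) (n : nat)
    (Omega : set 'rV[R]_n.+1) : Prop :=
  forall p : 'rV[R]_n.+1, boundary Omega p ->
    exists (Q : 'M[R]_n.+1) (gamma : 'rV[R]_n -> R) (k : R),
      [/\ Q *m Q^T = 1%:M, k.-lipschitz gamma &
          \forall y \near p, boundary Omega y <->
            (y *m Q) 0 ord0 = gamma (col' ord0 (y *m Q))].

Definition lipschitz_domain (R : realType) (n : nat)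
    (Omega : set 'rV[R]_n.+1) : Prop :=
  domain Omega /\ lipschitz_boundary Omega.

(** * Tonelli Lagrangians *)

(* In finite dimension, continuity (resp. differentiability) of p |-> 'd f p
   as a map into the space of linear forms amounts to that of p |-> 'd f p h
   for each fixed h. *)
Definition is_C1 (R : realType) (V : normedModType R) (f : V -> R) : Prop :=
  (forall p, differentiable f p) /\
  forall h : V, continuous (fun p => 'd f p h).

Definition is_C2 (R : realType) (V : normedModType R) (f : V -> R) : Prop :=
  is_C1 f /\ forall h : V, is_C1 (fun p => 'd f p h : R).

Definition hessian_v (R : realType) (n : nat)
    (L : 'rV[R]_n -> 'rV[R]_n -> R) (x v : 'rV[R]_n) : 'M[R]_n :=
  \matrix_(i, j) 'D_(delta_mx 0 i) ('D_(delta_mx 0 j) (L x)) v.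

Definition posdefmx (R : realType) (n : nat) (H : 'M[R]_n) : Prop :=
  forall w : 'rV[R]_n, w != 0 -> 0 < (w *m H *m w^T) 0 0.

Definition nondecreasing_superlinear (R : realType) (theta : R -> R) : Prop :=
  [/\ forall r : R, 0 <= r -> 0 <= theta r,
      forall r s : R, 0 <= r -> r <= s -> theta r <= theta s &
      theta r / r @[r --> +oo] --> +oo].

Definition tonelli (R : realType) (n : nat)
    (L : 'rV[R]_n -> 'rV[R]_n -> R) : Prop :=
  [/\ is_C2 (fun p : 'rV[R]_n * 'rV[R]_n => L p.1 p.2),
      forall x v, posdefmx (hessian_v L x v) &
      exists (theta1 theta2 : R -> R) (c0 : R),
        [/\ nondecreasing_superlinear theta1,
            nondecreasing_superlinear theta2,
            0 < c0 &
            forall x v, theta1 (enorm v) - c0 <= L x v /\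
                        L x v <= theta2 (enorm v)]].

(** * Sobolev curves *)

Definition test_function (R : realType) (s t : R) (phi : R -> R) : Prop :=
  [/\ forall r : R, derivable phi r 1,
      continuous (phi^`())%classic &
      exists K : set R, [/\ compact K, K `<=` `]s, t[ &
        forall r, ~ K r -> phi r = 0]].

Definition weak_derivative (R : realType) (s t : R) (f w : R -> R) : Prop :=
  forall phi, test_function s t phi ->
    \int[lebesgue_measure]_(r in `]s, t[) (f r * (phi^`())%classic r) =
    - \int[lebesgue_measure]_(r in `]s, t[) (w r * phi r).

(* xi is the continuous representative on [s, t] of an element of
   W^{1,1}([s, t]; R^n), and w is its weak derivative (unique up to a
   negligible set). *)
Definition W11 (R : realType) (n : nat) (s t : R) (xi w : R -> 'rV[R]_n) :
    Prop :=
  {within `[s, t], continuous xi} /\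
  forall i : 'I_n,
    [/\ lebesgue_measure.-integrable `]s, t[ (fun r => (xi r 0 i)%:E),
        lebesgue_measure.-integrable `]s, t[ (fun r => (w r 0 i)%:E) &
        weak_derivative s t (fun r => xi r 0 i) (fun r => w r 0 i)].

(* Admissible curves come paired with their weak derivative. *)
Definition Gamma (R : realType) (n : nat) (Omega : set 'rV[R]_n) (s t : R)
    (x y : 'rV[R]_n) : set ((R -> 'rV[R]_n) * (R -> 'rV[R]_n)) :=
  [set c | [/\ W11 s t c.1 c.2,
               forall r, r \in `[s, t] -> closure Omega (c.1 r),
               c.1 s = x & c.1 t = y]].

(** * Action, potential and critical value *)

(* L is bounded below, so the integral is well defined; it may be +oo. *)
Definition action (R : realType) (n : nat) (L : 'rV[R]_n -> 'rV[R]_n -> R)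
    (t : R) (c : (R -> 'rV[R]_n) * (R -> 'rV[R]_n)) : \bar R :=
  (\int[lebesgue_measure]_(s in `[0%R, t]) (L (c.1 s) (c.2 s))%:E)%E.

Definition min_action (R : realType) (n : nat) (Omega : set 'rV[R]_n)
    (L : 'rV[R]_n -> 'rV[R]_n -> R) (t : R) (x y : 'rV[R]_n) : \bar R :=
  ereal_inf [set action L t c | c in Gamma Omega 0 t x y].

Definition potential (R : realType) (n : nat) (Omega : set 'rV[R]_n)
    (L : 'rV[R]_n -> 'rV[R]_n -> R) (x y : 'rV[R]_n) : \bar R :=
  ereal_inf [set min_action Omega L t x y | t in [set t | 0 < t]].

Definition critical_value (R : realType) (n : nat) (Omega : set 'rV[R]_n)
    (L : 'rV[R]_n -> 'rV[R]_n -> R) : \bar R :=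
  (- ereal_inf [set (p.1^-1)%R%:E * min_action Omega L p.1 p.2 p.2 |
                p in [set p : R * 'rV[R]_n | (0 < p.1)%R /\
                                             closure Omega p.2]])%E.

Definition value_function (R : realType) (n : nat) (Omega : set 'rV[R]_n)
    (L : 'rV[R]_n -> 'rV[R]_n -> R) (g : 'rV[R]_n -> R) (x : 'rV[R]_n) :
    \bar R :=
  ereal_inf [set ((g y)%:E + potential Omega L y x)%E | y in boundary Omega].

(* Main.v *)
(** Let [x] be in [Omega_rho].  Take a curve [xi] from the boundary to [x] that
    is optimal up to [eps] and cut its time interval into many small steps.  If
    the mean velocity of a step is at most [K], convexity of [L] in the velocity
    bounds the action of the step from below by that of the chord, up to an
    error that vanishes with the mesh.  If the mean velocity exceeds [K],
    superlinearity makes it cheaper to run along the chord at unit speed, since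
    the final time is free in the potential.  So up to [eps] the end of [xi] may
    be replaced by a polygon ending at [x], run at speeds bounded by a constant
    [K] that depends only on [L], inside a ball around [x] contained in [Omega],
    during a time comparable to [rho / K].

    Shifting the polygon by multiples of [z] and [- z] that grow linearly in time
    gives competitors ending at [x + z] and [x - z].  The positions and
    velocities stay in a fixed compact set, on which the second derivatives of
    [L] are bounded, so the first-order terms of the two competitors cancel and a
    multiple of [|z|^2] remains.

    The value is finite because an interior point is joined to a boundary point
    by a segment contained in the closure of [Omega]. *)
Require Import Defs.
From mathcomp Require Import all_boot all_order all_algebra.
From mathcomp Require Import all_classical all_reals all_analysis.
From mathcomp Require Import measurable_realfun ring lra.
Import Order.TTheory GRing.Theory Num.Theory.
Import numFieldNormedType.Exports.
Local Open Scope classical_set_scope.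
Local Open Scope ring_scope.
Set Implicit Arguments.
Unset Strict Implicit.
Unset Printing Implicit Defensive.

(** * Calculus along lines and compactness *)

(** The argument runs on almost optimal curves, so the speed bound [K], the duration [T] and the
    bound on second differences are all fixed before the error [e], which is sent to 0 last.

    Two obstacles shape the proof. The velocity of a Sobolev curve is known only through test
    functions that vanish near the endpoints, whereas increments over subintervals and prolongation
    by a segment are needed; both come from an integration by parts with boundary terms. Moreover,
    replacing a piece of curve by its chord leaves an error affine in the velocity, which is
    integrable but not bounded; it is charged to a penalty proportional to one plus the speed, whose
    total integral can be made small.

    The shifted polygons are never assembled into curves: the bound of u(p + tau v) by u(p) + tau
    sup L along the segment is applied step by step, to both shifts at once. The speed threshold is
    [K = CM + 1], where L is at most B at unit speed and L >= (B + 1)|v| - CM everywhere. *)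

Lemma continuous_compact_modulus (R : realType) (V W : normedModType R)
    (f : V -> W) (A : set V) (e : R) :
  compact A -> {within A, continuous f} -> 0 < e ->
  exists2 d : R, 0 < d &
    forall p q, A p -> A q -> `|p - q| < d -> `|f p - f q| < e.
Proof.
move=> cA /subspace_continuousP cf e0.
pose P (d : R) p := A p -> forall q, A q -> `|p - q| < d -> `|f p - f q| < e.
have H : \forall d \near (0:R)^'+, A `<=` P d.
  move/compact_near_coveringP: cA => cA.
  apply: (cA _ _ P) => x Ax.
  have /cvgrPdist_lt /(_ (e / 2)) := cf x Ax.
  rewrite divr_gt0// near_withinE => /(_ isT) /nbhs_ballP[r /= r0 Hr].
  exists (ball x (r / 2), [set d : R | d < r / 2]) => /=.
    split; first by apply: nbhsx_ballx; rewrite divr_gt0.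
    by apply: nbhs_right_lt; rewrite divr_gt0.
  move=> [p d] /= [xp dr] Ap q Aq pq.
  have xp' : `|x - p| < r / 2 by move: xp; rewrite -ball_normE.
  have h1 : `|f x - f p| < e / 2.
    by apply: Hr => //; rewrite -ball_normE /ball_ /=; apply: (lt_le_trans xp'); lra.
  have h2 : `|f x - f q| < e / 2.
    apply: Hr => //; rewrite -ball_normE /ball_ /=.
    rewrite -(subrK p x) -addrA; apply: (le_lt_trans (ler_normD _ _)).
    have := lt_trans pq dr; lra.
  rewrite -(subrK (f x) (f p)) -addrA; apply: (le_lt_trans (ler_normD _ _)).
  rewrite distrC; lra.
near (0:R)^'+ => d.
exists d => [//|p q Ap].
have /(_ p Ap Ap) : A `<=` P d by near: d; exact: H.
exact.
Unshelve. all: by end_near. Qed.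

Lemma continuous_compact_bound (R : realType) (V : normedModType R)
    (f : V -> R) (A : set V) :
  compact A -> continuous f ->
  exists2 M : R, 0 <= M & forall p, A p -> `|f p| <= M.
Proof.
move=> cA cf.
have /compact_bounded [M [_ /(_ (`|M| + 1))]] : compact (f @` A).
  apply: continuous_compact => //; exact: continuous_subspaceT.
rewrite (le_lt_trans (ler_norm _)) ?ltrDl// => /(_ isT) H.
exists (`|M| + 1); first by rewrite addr_ge0.
by move=> p Ap; apply: H; exists p.
Qed.

Lemma is_derive_along_line (R : realType) (V : normedModType R) (f : V -> R)
    (p h : V) (l : R) :
  differentiable f (p + l *: h) ->
  is_derive l 1 (fun s : R => f (p + s *: h)) ('d f (p + l *: h) h).
Proof.
move=> df.
have dg : derivable f (p + l *: h) h by exact: diff_derivable.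
have E : (fun e : R => e^-1 *: ((f (e *: h + (p + l *: h)) - f (p + l *: h)) : R^o)) =
   (fun e : R => e^-1 *: ((f (p + ((e *: (1 : R)) + l) *: h) - f (p + l *: h)) : R^o)).
  apply/funext => e; congr (_ *: (f _ - _)).
  by rewrite scalerDl [e *: (1 : R)]mulr1 addrCA.
split.
  by rewrite /derivable; move: dg; rewrite /derivable /= E.
by rewrite -(deriveE _ df) /derive /= E.
Qed.

(** The mean value theorem on each side of [p] gives slopes at parameters [b < a]; applied a third
    time, to the slope, it compares them. *)
Lemma second_difference_le (R : realType) (V : normedModType R) (f : V -> R)
    (p h : V) (M : R) :
  is_C2 f ->
  (forall s : R, `|s| <= 1 -> 'd (fun q => 'd f q h : R) (p + s *: h) h <= M) ->
  0 <= M ->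
  f (p + h) + f (p - h) - 2 * f p <= 2 * M.
Proof.
move=> [[df _] C1] HM M0.
have d1 (l : R) : is_derive l 1 (fun s : R => f (p + s *: h)) ('d f (p + l *: h) h).
  by apply: is_derive_along_line.
have d2 (l : R) : is_derive l 1 (fun s : R => 'd f (p + s *: h) h : R)
    ('d (fun q => 'd f q h : R) (p + l *: h) h).
  by apply: (@is_derive_along_line _ _ (fun q => 'd f q h : R)); case: (C1 h).
have cts (k : R -> R) (dk : R -> R) (a b : R) :
    (forall l : R, is_derive l 1 k (dk l)) -> {within `[a, b], continuous k}.
  move=> H; apply: derivable_within_continuous => x _.
  by have [] := H x.
have [|a /andP[/= a0 a1]] := @MVT _ _ _ 0 1 (@ltr01 R) (fun x _ => d1 x).
  exact: cts d1.
rewrite scale1r scale0r addr0 subr0 mulr1 => Ea.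
have [||b /andP[/= b0 b1]] := @MVT _ _ _ (-1) 0 _ (fun x _ => d1 x).
- by rewrite oppr_lt0.
- exact: cts d1.
rewrite scaleN1r scale0r addr0 sub0r opprK mulr1 => Eb.
rewrite !bnd_simp in a0 a1 b0 b1.
have ba : b < a by exact: lt_trans a0.
have [|c /andP[/= c0 c1]] := @MVT _ _ _ b a ba (fun x _ => d2 x).
  exact: cts d2.
rewrite !bnd_simp in c0 c1.
move=> Ec.
have Mc : 'd (fun q => 'd f q h : R) (p + c *: h) h <= M.
  by apply: HM; rewrite ler_norml; apply/andP; split; apply: ltW;
     [apply: lt_trans c0|apply: lt_trans a1].
have -> : f (p + h) + f (p - h) - 2 * f p =
   (f (p + h) - f p) - (f p - f (p - h)) by ring.
rewrite Ea Eb Ec.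
(* Both parameters lie in ]-1, 1[, so [a - b] is less than 2; [M >= 0] lets 2 replace it. *)
apply: (@le_trans _ _ (M * (a - b))); first by rewrite ler_pM2r// subr_gt0.
rewrite mulrC ler_wpM2r//; lra.
Qed.

Lemma convex_along_line (R : realType) (V : normedModType R) (f : V -> R)
    (p h : V) :
  is_C2 f ->
  (forall s, 0 <= 'd (fun q => 'd f q h : R) (p + s *: h) h) ->
  f p + 'd f p h <= f (p + h).
Proof.
move=> [[df _] C1] HM.
have d1 (l : R) : is_derive l 1 (fun s : R => f (p + s *: h)) ('d f (p + l *: h) h).
  by apply: is_derive_along_line.
have d2 (l : R) : is_derive l 1 (fun s : R => 'd f (p + s *: h) h : R)
    ('d (fun q => 'd f q h : R) (p + l *: h) h).
  by apply: (@is_derive_along_line _ _ (fun q => 'd f q h : R)); case: (C1 h).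
have cts (k : R -> R) (dk : R -> R) (a b : R) :
    (forall l : R, is_derive l 1 k (dk l)) -> {within `[a, b], continuous k}.
  move=> H; apply: derivable_within_continuous => x _.
  by have [] := H x.
have [|a /andP[/= a0 a1]] := @MVT _ _ _ 0 1 (@ltr01 R) (fun x _ => d1 x).
  exact: cts d1.
rewrite scale1r scale0r addr0 subr0 mulr1 => Ea.
rewrite !bnd_simp in a0 a1.
have [|c /andP[/= c0 c1]] := @MVT _ _ _ 0 a a0 (fun x _ => d2 x).
  exact: cts d2.
rewrite scale0r addr0 subr0 => Ec.
have : 0 <= 'd (fun q => 'd f q h : R) (p + c *: h) h * a.
  by rewrite mulr_ge0// ltW.
by rewrite -Ec; lra.
Qed.

(** * Second-order estimates for the Lagrangian *)

(** The outer slot is linear because a differential is; the inner one because differentiating is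
    linear in the function, which is what [TD] and [TZ] record. *)
Lemma second_differential_expand (R : realType) (V : normedModType R)
    (f : V -> R) (I : finType) (e : I -> V) (c : I -> R) (x : V) :
  is_C2 f ->
  'd (fun q => 'd f q (\sum_k c k *: e k) : R) x (\sum_k c k *: e k) =
  \sum_k \sum_i c k * c i * ('d (fun q => 'd f q (e k) : R) x (e i) : R).
Proof.
move=> [_ C1].
pose T h k : R := 'd (fun q => 'd f q h : R) x k.
have dh h : differentiable (fun q => 'd f q h : R) x by case: (C1 h).
have TD h1 h2 k : T (h1 + h2) k = T h1 k + T h2 k.
  rewrite /T -!deriveE// -deriveD; try exact: diff_derivable.
  by congr ('D_k _ x); apply/funext => q; rewrite linearD.
have TZ (a : R) h k : T (a *: h) k = a * T h k.
  rewrite /T -!deriveE// -[RHS]/(a *: (_ : R^o)) -deriveZ; last exact: diff_derivable.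
  by congr ('D_k _ x); apply/funext => q; rewrite linearZ.
have TS k : T (\sum_k c k *: e k) k = \sum_i c i * T (e i) k.
  elim/big_rec2 : _ => [|i y1 y2 _ <-]; last by rewrite TD TZ.
  by have := TZ 0 0 k; rewrite scale0r mul0r.
rewrite -/(T _ _) TS; apply: eq_bigr => k _.
rewrite /T linear_sum /= mulr_sumr; apply: eq_bigr => i _.
by rewrite linearZ /= mulrA.
Qed.

(** [is_C2] gives continuity of the second differential only for each fixed pair of directions.
    Expanding in a finite frame leaves finitely many continuous coefficients, hence a bound uniform
    in [h]. *)
Lemma second_differential_bound (R : realType) (V : normedModType R)
    (f : V -> R) (I : finType) (e : I -> V) (c : I -> V -> R) (A : set V) :
  is_C2 f -> compact A ->
  (forall h, h = \sum_k c k h *: e k) -> (forall k h, `|c k h| <= `|h|) ->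
  exists2 C : R, 0 <= C & forall x h, A x ->
    'd (fun q => 'd f q h : R) x h <= C * `|h| ^+ 2.
Proof.
move=> C2 cA hE ch.
have [_ C1] := C2.
have /choice[M HM] : forall ki : I * I, exists M : R, 0 <= M /\ forall p, A p ->
    `|('d (fun q => 'd f q (e ki.1) : R) p (e ki.2) : R)| <= M.
  move=> [k i] /=; case: (C1 (e k)) => _ /(_ (e i)) ck.
  by have [M M0 H] := continuous_compact_bound cA ck; exists M.
exists (\sum_k \sum_i M (k, i)).
  by apply: sumr_ge0 => k _; apply: sumr_ge0 => i _; case: (HM (k, i)).
move=> x h Ax; rewrite {1 2}[h]hE second_differential_expand// mulr_suml.
apply: ler_sum => k _; rewrite mulr_suml; apply: ler_sum => i _.
apply: (le_trans (ler_norm _)); rewrite normrM mulrC.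
case: (HM (k, i)) => M0 /(_ x Ax) /= H.
by rewrite ler_pM// normrM expr2 ler_pM.
Qed.

Section Lagrangian.
Variables (R : realType) (m : nat).
Let V := 'rV[R]_m.+1.
Implicit Types (x v p q : V).

Lemma row_norm_coord v j : `|v 0 j| <= `|v|.
Proof.
rewrite [in leRHS]/Num.Def.normr /= mx_normrE.
by apply: (le_bigmax _ _ ((0, j) : 'I_1 * 'I_m.+1)).
Qed.

Lemma row_norm_le v (r : R) : 0 <= r -> (forall j, `|v 0 j| <= r) -> `|v| <= r.
Proof.
move=> r0 H; rewrite [in leLHS]/Num.Def.normr /= mx_normrE.
by apply: bigmax_le => // -[i j] _ /=; rewrite ord1.
Qed.

Lemma row_norm_attained v : exists j, `|v| = `|v 0 j|.
Proof.
have [[i j] _ Hj] : exists2 ij : 'I_1 * 'I_m.+1, true &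
    \big[Order.max/0]_ij `|v ij.1 ij.2| = `|v ij.1 ij.2|.
  have := @eq_bigmax _ R ('I_1 * 'I_m.+1)%type 0 (0, 0) predT (fun ij => `|v ij.1 ij.2|) isT.
  by move=> [//|ij _ E]; exists ij.
exists j; rewrite [in LHS]/Num.Def.normr /= mx_normrE Hj /=; congr (`|v _ _|).
exact/ord1.
Qed.

Lemma pair_sumE (I : finType) (F G : I -> V) :
  \sum_i ((F i, G i) : V * V) = (\sum_i F i, \sum_i G i).
Proof.
apply: (big_rec3 (fun a b c : _ => c = (a, b) :> V * V)) => // i a b c _ ->.
by [].
Qed.

Lemma pair0_sum_delta v :
  ((0, v) : V * V) = \sum_i v 0 i *: ((0, delta_mx 0 i) : V * V).
Proof.
under eq_bigr do rewrite [_ *: (_, _)]surjective_pairing /= scaler0.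
by rewrite pair_sumE -row_sum_delta big1.
Qed.

Lemma pair_sum_delta0 v :
  ((v, 0) : V * V) = \sum_i v 0 i *: ((delta_mx 0 i, 0) : V * V).
Proof.
under eq_bigr do rewrite [_ *: (_, _)]surjective_pairing /= scaler0.
by rewrite pair_sumE -row_sum_delta big1.
Qed.

(** This frame of the product space serves twice: to bound the second differential of L, and to
    prove L measurable along a curve. *)
Definition pair_basis (k : 'I_m.+1 + 'I_m.+1) : V * V :=
  match k with inl i => (delta_mx 0 i, 0) | inr i => (0, delta_mx 0 i) end.

Definition pair_coord (k : 'I_m.+1 + 'I_m.+1) (h : V * V) : R :=
  match k with inl i => h.1 0 i | inr i => h.2 0 i end.

Lemma pair_basisE (h : V * V) : h = \sum_k pair_coord k h *: pair_basis k.
Proof.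
rewrite [h in LHS]surjective_pairing big_sumType /=.
by rewrite -pair0_sum_delta -pair_sum_delta0; congr pair; rewrite /= ?addr0 ?add0r.
Qed.

Lemma pair_coord_le k h : `|pair_coord k h| <= `|h|.
Proof.
rewrite prod_normE le_max; case: k => i /=; rewrite row_norm_coord ?orbT//.
Qed.

Lemma closed_row_ball (r : R) : closed [set v : V | `|v| <= r].
Proof.
have -> : [set v : V | `|v| <= r] = Num.Def.normr @^-1` [set y : R | y <= r] by [].
apply: closed_comp; last exact: closed_le.
by move=> v _; exact: norm_continuous.
Qed.

Lemma compact_pair_ball (r : R) :
  compact [set p : V * V | `|p| <= r].
Proof.
have -> : [set p : V * V | `|p| <= r] =
   [set v : V | `|v| <= r] `*` [set v : V | `|v| <= r].
  apply/seteqP; split => -[a b] /=; rewrite prod_normE /= ge_max.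
    by move/andP.
  by move=> H; apply/andP.
have K : compact [set v : V | `|v| <= r].
  apply: bounded_closed_compact.
    exists r; split; first exact: num_real.
    by move=> M rM v /= /le_trans; apply; exact: ltW.
  exact: closed_row_ball.
exact: compact_setX.
Qed.

Variable L : V -> V -> R.
Hypothesis L_C2 : is_C2 (fun p : V * V => L p.1 p.2).
Let f := fun p : V * V => L p.1 p.2.

Definition gradv x v j : R := 'd f (x, v) ((0, delta_mx 0 j) : V * V).

Lemma lagrangian_second_difference (r : R) :
  exists2 C : R, 0 <= C & forall p q a b : V,
    `|p| <= r -> `|q| <= r -> `|a| <= r -> `|b| <= r ->
    L (p + a) (q + b) + L (p - a) (q - b) - 2 * L p q
      <= C * (`|a| ^+ 2 + `|b| ^+ 2).
Proof.
(* The points [p + s *: a] and [q + s *: b] with [|s| <= 1] have norm at most [2 * r]. *)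
have [C C0 HC] := second_differential_bound L_C2 (@compact_pair_ball (2 * r))
  pair_basisE pair_coord_le.
exists (2 * C); first by rewrite mulr_ge0.
move=> p q a b pr qr ar br.
have := @second_difference_le _ _ f (p, q) (a, b) (C * `|(a, b)| ^+ 2) L_C2.
move=> H; apply: (le_trans (H _ _)).
- move=> s s1; apply: HC => /=; rewrite prod_normE /= ge_max.
  have aux (u w : V) : `|u| <= r -> `|w| <= r -> `|u + s *: w| <= 2 * r.
    move=> ur wr; rewrite (le_trans (ler_normD _ _))// normrZ.
    have : `|s| * `|w| <= 1 * r by apply: ler_pM.
    lra.
  by rewrite !aux.
- by rewrite mulr_ge0// exprn_ge0.
rewrite -mulrA ler_wpM2l// ler_wpM2l//.
rewrite prod_normE /=; case: (leP `|a| `|b|) => _.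
  by rewrite ler_wpDl// exprn_ge0.
by rewrite ler_wpDr// exprn_ge0.
Qed.

Lemma continuous_lagrangian : continuous f.
Proof.
move=> p; apply: differentiable_continuous; by case: L_C2 => -[].
Qed.

Lemma continuous_gradv j : continuous (fun p : V * V => gradv p.1 p.2 j).
Proof.
case: L_C2 => -[_ /(_ (0, delta_mx 0 j))] H _.
have -> // : (fun p : V * V => gradv p.1 p.2 j) =
   (fun p : V * V => 'd f p ((0, delta_mx 0 j) : V * V) : R).
by apply/funext => -[].
Qed.

(** The matrix is made of iterated partial derivatives in v, whereas the Taylor arguments use the
    joint differential on the product. This identity carries positive definiteness from one to the
    other. *)
Lemma hessian_v_form x v (w : V) :
  (w *m hessian_v L x v *m w^T) 0 0 =
  'd (fun z : V * V => 'd f z ((0, w) : V * V) : R) (x, v) ((0, w) : V * V).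
Proof.
have [[df _] C1] := L_C2.
pose e (i : 'I_m.+1) : V * V := (0, delta_mx 0 i).
have wE : ((0, w) : V * V) = \sum_i w 0 i *: e i by exact: pair0_sum_delta.
rewrite wE second_differential_expand//.
have part (g : V * V -> R) (y u k : V) : differentiable g (y, u) ->
    'D_k (fun z => g (y, z)) u = 'd g (y, u) ((0, k) : V * V).
  move=> dg; rewrite -(deriveE _ dg) /derive /=.
  have -> // : (fun s : R => s^-1 *: (g (y, s *: k + u) - g (y, u) : R^o)) =
    (fun s : R => s^-1 *: (g (s *: ((0, k) : V * V) + (y, u)) - g (y, u) : R^o)).
  apply/funext => s; congr (_ *: (g _ - _)).
  by congr pair; rewrite /= scaler0 add0r.
rewrite mxE; apply: eq_bigr => j _.
rewrite !mxE mulr_suml; apply: eq_bigr => i _.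
rewrite !mxE.
have -> : 'D_(delta_mx 0 j) (L x) = fun u => 'd f (x, u) (e j) : R.
  by apply/funext => u; rewrite -(part f).
rewrite (part (fun z : V * V => 'd f z (e j) : R)); last by case: (C1 (e j)).
rewrite -/(e i); ring.
Qed.

Hypothesis L_pos : forall x v, posdefmx (hessian_v L x v).

(** Convexity on the segment from [q] to [v] with [x] fixed; the zero direction is separate since
    [posdefmx] concerns nonzero vectors. *)
Lemma lagrangian_gradient_ineq x v q :
  L x q + \sum_j gradv x q j * (v - q) 0 j <= L x v.
Proof.
set w := v - q.
have H := @convex_along_line _ _ f (x, q) (0, w) L_C2.
have -> : L x v = f ((x, q) + ((0, w) : V * V)).
  by rewrite /f /= addr0 /w addrC subrK.
apply: le_trans (H _).
  rewrite lerD2l.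
  rewrite pair0_sum_delta linear_sum /=; apply: ler_sum => j _; rewrite linearZ /=.
  by rewrite mulrC.
move=> s.
have [->|w0] := eqVneq w 0.
  by rewrite linear0.
have -> : (x, q) + s *: ((0, w) : V * V) = (x, q + s *: w).
  by congr pair; rewrite /= scaler0 addr0.
rewrite -hessian_v_form; apply/ltW; exact: L_pos.
Qed.

End Lagrangian.

(** * Measurability of the Lagrangian along a curve *)

(* Rounding the coordinates to the grid of mesh 1/(k+1) makes the composite a
   function of countably many values; it converges by continuity of [F]. *)
Lemma measurable_fun_continuous_coord (R : realType) (d : measure_display)
    (T : measurableType d) (D : set T) (V : normedModType R) (I : finType)
    (e : I -> V) (c : I -> V -> R) (a : T -> V) (F : V -> R) :
  measurable D ->
  (forall h, h = \sum_i c i h *: e i) ->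
  (forall i, measurable_fun D (c i \o a)) -> continuous F ->
  measurable_fun D (F \o a).
Proof.
move=> mD hE mc cF.
pose N (k : nat) (s : T) : {ffun I -> int} :=
  [ffun i => Num.floor (c i (a s) * k.+1%:R)].
pose G (k : nat) (z : {ffun I -> int}) : V :=
  \sum_i ((z i)%:~R / k.+1%:R) *: e i.
apply: (@measurable_fun_cvg _ _ _ D (fun k s => F (G k (N k s)))).
  move=> k _ Y mY.
  have -> : D `&` (fun s => F (G k (N k s))) @^-1` Y =
      \bigcup_(z in [set z | Y (F (G k z))]) (D `&` \bigcap_(i in [set: I])
         (D `&` (c i \o a) @^-1` [set y | (z i)%:~R / k.+1%:R <= y < (z i + 1)%:~R / k.+1%:R])).
    have k0 : 0 < k.+1%:R :> R by rewrite ltr0n.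
    apply/seteqP; split => [s [Ds Ys]|s [z Yz [Ds H]]].
      exists (N k s) => //; split=> // i _; split=> //=.
      rewrite /N ffunE ler_pdivrMr// ltr_pdivlMr//.
      by rewrite floor_le floorD1_gt.
    split => //=; have -> : N k s = z; last exact: Yz.
    apply/ffunP => i; rewrite /N ffunE; apply: floor_def.
    have [_ /=] := H i Logic.I.
    by rewrite ler_pdivrMr// ltr_pdivlMr//.
  rewrite bigcup_mkcond; apply: countable_bigcupT_measurable => [|z].
    exact: countableP.
  case: ifP => // _; apply: measurableI => //.
  apply: fin_bigcap_measurable.
    exact: finite_finset.
  move=> i _; apply: mc => //.
  have -> : [set y : R | (z i)%:~R / k.+1%:R <= y < (z i + 1)%:~R / k.+1%:R] =
    `[(z i)%:~R / k.+1%:R, (z i + 1)%:~R / k.+1%:R[%classic.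
    by apply/seteqP; split => y /=; rewrite in_itv.
  exact: measurable_itv.
move=> s Ds.
apply: (@continuous_cvg _ _ _ _ _ _ F); first exact: cF.
have : (fun k : nat => (\sum_i `|e i|) * (k.+1%:R^-1 : R)) @ \oo --> (0 : R).
  rewrite -[X in _ --> X](mulr0 (\sum_i `|e i|)).
  by apply: cvgMr; exact: cvg_harmonic.
move=> /cvgrPdist_le H; apply/cvgrPdist_le => eps eps0.
near=> k.
have Hk : `|0 - (\sum_i `|e i|) * k.+1%:R^-1| <= eps.
  by near: k; exact: (H eps eps0).
apply: le_trans Hk.
rewrite sub0r normrN [leRHS]ger0_norm; last first.
  by rewrite divr_ge0// sumr_ge0.
rewrite {1}[a s]hE /G -sumrB mulr_suml; apply: le_trans (ler_norm_sum _ _ _) _.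
apply: ler_sum => i _; rewrite -scalerBl normrZ mulrC ler_wpM2l// /N ffunE.
have k0 : 0 < k.+1%:R :> R by rewrite ltr0n.
rewrite -[c i (a s)](mulfK (lt0r_neq0 k0)) -mulrBl normrM.
rewrite [X in _ * X]gtr0_norm ?invr_gt0// ler_piMl ?invr_ge0// ?ltW//.
rewrite ger0_norm ?subr_ge0 ?mulfK ?lt0r_neq0// ?floor_le//.
have := floorD1_gt (c i (a s) * k.+1%:R); rewrite intrD; lra.
Unshelve. all: by end_near. Qed.

Lemma measurable_lagrangian (R : realType) (m : nat)
    (F : 'rV[R]_m.+1 -> 'rV[R]_m.+1 -> R) (D : set R) (x v : R -> 'rV[R]_m.+1) :
  measurable D -> continuous (fun p : 'rV[R]_m.+1 * 'rV[R]_m.+1 => F p.1 p.2) ->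
  (forall i, measurable_fun D (fun s => x s 0 i)) ->
  (forall i, measurable_fun D (fun s => v s 0 i)) ->
  measurable_fun D (fun s => F (x s) (v s)).
Proof.
move=> mD cF mx mv.
apply: (@measurable_fun_continuous_coord _ _ _ D _ _ (@pair_basis R m)
  (@pair_coord R m) (fun s => (x s, v s)) (fun p => F p.1 p.2)) => //.
- exact: pair_basisE.
- by case.
Qed.

(** * Weak derivatives and integration by parts *)

Section Smoothstep.
Variable R : realType.
Implicit Types x a b : R.

(** The remainder is at most [h ^+ 2] for each of the four sign patterns. Shifted copies of this C^1
    function combine into cutoffs without gluing pieces. *)
Lemma is_derive_mul_norm x : is_derive x 1 (fun y : R => y * `|y|) (2 * `|x|).
Proof.
have est h : `|(x + h) * `|x + h| - x * `|x| - 2 * `|x| * h| <= h ^+ 2.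
  rewrite ler_norml; apply/andP.
  have := mulr_ge0 (normr_ge0 x) (normr_ge0 (x + h)).
  have := sqr_ge0 x; have := sqr_ge0 (x + h).
  by case: (ger0P x) => x0; case: (ger0P (x + h)) => xh0; split; nra.
have cv : h^-1 *: ((fun y : R => y * `|y|) (h *: (1 : R) + x) - x * `|x|)
    @[h --> (0:R)^'] --> 2 * `|x|.
  apply/cvgrPdist_le => e e0; near=> h.
  have h0 : h != 0 by near: h; exact: nbhs_dnbhs_neq.
  have he : `|h| <= e.
    near: h; apply: dnbhs0_le; exact: e0.
  rewrite distrC /= [h%:A]mulr1 [h + x]addrC.
  have -> : h^-1 *: ((x + h) * `|x + h| - x * `|x|) - 2 * `|x| =
    h^-1 * ((x + h) * `|x + h| - x * `|x| - 2 * `|x| * h).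
    by rewrite /GRing.scale /= [RHS]mulrBr [h^-1 * (2 * `|x| * h)]mulrCA mulVf// mulr1.
  rewrite normrM normfV ler_pdivrMl ?normr_gt0//.
  apply: (le_trans (est h)).
  by rewrite -real_normK ?num_real// expr2 ler_wpM2l.
split; first by apply/cvg_ex; exists (2 * `|x|).
exact: cvg_lim cv.
Unshelve. all: by end_near. Qed.

Lemma is_derive_affine_mul_norm a b x :
  is_derive x 1 (fun y : R => (a * y + b) * `|a * y + b|) (a * (2 * `|a * x + b|)).
Proof.
have H := is_derive_mul_norm (a * x + b).
have H1 : is_derive x 1 (fun y : R => a * y + b) a.
  by apply: is_derive_eq; rewrite addr0 [_ *: _]mulr1.
have := @is_derive1_comp R (fun y : R => y * `|y|) (fun y => a * y + b) x _ _ H H1.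
by rewrite mulrC.
Qed.

(** A C^1, piecewise quadratic step with knots 0, 1/2 and 1, equal to 0 on the left and 1 on the
    right. Its derivative is [tent], the hat supported in [0, 1] with height 2 and mass 1. *)
Definition smoothstep x : R :=
  2^-1 + x * `|x| - 2 * ((x - 2^-1) * `|x - 2^-1|) + (x - 1) * `|x - 1|.

Definition tent x : R := 2 * (`|x| - 2 * `|x - 2^-1| + `|x - 1|).

Lemma smoothstep_le0 x : x <= 0 -> smoothstep x = 0.
Proof. by move=> ?; rewrite /smoothstep !ler0_norm; lra. Qed.

Lemma smoothstep_ge1 x : 1 <= x -> smoothstep x = 1.
Proof. by move=> ?; rewrite /smoothstep !ger0_norm; lra. Qed.

Lemma smoothstep_itv x : 0 <= smoothstep x <= 1.
Proof.
have [x0|x0] := leP x 0; first by rewrite smoothstep_le0// lexx ler01.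
have [x1|x1] := leP 1 x; first by rewrite smoothstep_ge1// ler01 lexx.
rewrite /smoothstep (gtr0_norm x0) (ltr0_norm (_ : x - 1 < 0)); last by lra.
by case: (ger0P (x - 2^-1)) => h; apply/andP; split; nra.
Qed.

Lemma tent_ge0 x : 0 <= tent x.
Proof.
rewrite /tent mulr_ge0// addrAC subr_ge0.
have := ler_normD x (x - 1).
have -> : x + (x - 1) = 2 * (x - 2^-1) by field.
by rewrite normrM ger0_norm.
Qed.

Lemma tent_ge1 x : 1 <= x -> tent x = 0.
Proof. by move=> ?; rewrite /tent !ger0_norm; lra. Qed.

Lemma continuous_tent : continuous tent.
Proof.
move=> x; rewrite /tent; apply: cvgMr; apply: cvgD; first apply: cvgB.
- by apply: cvg_norm.
- by apply: cvgMr; apply: cvg_norm; apply: cvgB => //; apply: cvg_cst.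
- by apply: cvg_norm; apply: cvgB => //; apply: cvg_cst.
Qed.

Lemma is_derive_affine_smoothstep a b x :
  is_derive x 1 (fun y : R => smoothstep (a * y + b)) (a * tent (a * x + b)).
Proof.
have H c := is_derive_affine_mul_norm a (b + c) x.
have := H 0; have := H (- 2^-1); have := H (- 1); rewrite addr0 => H1 H2 H3.
have -> : (fun y : R => smoothstep (a * y + b)) =
  (fun y => 2^-1 + (a * y + b) * `|a * y + b| -
   2 * ((a * y + (b - 2^-1)) * `|a * y + (b - 2^-1)|) +
   (a * y + (b - 1)) * `|a * y + (b - 1)|).
  by apply/funext => y; rewrite /smoothstep !addrA.
apply: is_derive_eq.
rewrite /tent !addrA scaler0 /= add0r; rewrite /GRing.scale /=; ring.
Qed.

End Smoothstep.

Lemma integrable_EFinD (R : realType) (d : measure_display)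
    (T : measurableType d) (mu : {measure set T -> \bar R}) (D : set T)
    (f g : T -> R) : measurable D ->
  mu.-integrable D (EFin \o f) -> mu.-integrable D (EFin \o g) ->
  mu.-integrable D (EFin \o (fun r => f r + g r)).
Proof. by move=> mD intf intg; have := integrableD mD intf intg. Qed.

Lemma integrable_EFinB (R : realType) (d : measure_display)
    (T : measurableType d) (mu : {measure set T -> \bar R}) (D : set T)
    (f g : T -> R) : measurable D ->
  mu.-integrable D (EFin \o f) -> mu.-integrable D (EFin \o g) ->
  mu.-integrable D (EFin \o (fun r => f r - g r)).
Proof. by move=> mD intf intg; have := integrableB mD intf intg. Qed.

(** * Cutoff functions and integration by parts up to the endpoints *)

Section Intervals.
Variable R : realType.
Implicit Types (f g h : R -> R) (s t : R).
Notation mu := (@lebesgue_measure R).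

Lemma within_continuous_dist (V : normedModType R) (h : R -> V) s t c (e : R) :
  {within `[s, t], continuous h} -> c \in `[s, t] -> 0 < e ->
  exists2 d : R, 0 < d &
    forall r, r \in `[s, t] -> `|c - r| < d -> `|h c - h r| < e.
Proof.
move=> /subspace_continuousP ch cst e0.
have /cvgrPdist_lt /(_ e e0) := ch c cst.
rewrite near_withinE => /nbhs_ballP[d /= d0 H].
by exists d => // r rst cr; apply: H.
Qed.

Lemma continuous_itv_integrable f s t :
  {within `[s, t], continuous f} -> mu.-integrable `]s, t[ (EFin \o f).
Proof.
move=> cf; apply: (@integrableS _ _ _ mu `[s, t]) => //.
  exact: subset_itv_oo_cc.
by apply: continuous_compact_integrable => //; exact: segment_compact.
Qed.

Lemma integrable_mul_continuous f g s t :
  mu.-integrable `]s, t[ (EFin \o f) -> {within `[s, t], continuous g} ->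
  mu.-integrable `]s, t[ (EFin \o (fun r => f r * g r)).
Proof.
move=> intf cg.
have -> : EFin \o (fun r => f r * g r) = ((EFin \o f) \* (EFin \o g))%E.
  by apply/funext => r; rewrite /= EFinM.
apply: integrableMl => //.
  have /integrableP[/measurable_EFinP mg _] := continuous_itv_integrable cg.
  exact: mg.
have /compact_bounded[M [_ H]] := continuous_compact cg (@segment_compact R s t).
exists M; split; first exact: num_real.
move=> N MN r /= rst; apply: (H N MN); exists r => //.
exact: subset_itv_oo_cc.
Qed.

Lemma Rintegral_derive f g s t : s < t ->
  (forall r : R, is_derive r 1 f (g r)) -> continuous g ->
  \int[mu]_(r in `]s, t[) g r = f t - f s.
Proof.
move=> st df cg.
have cgw : {within `[s, t], continuous g} by exact: continuous_subspaceT.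
have cf : continuous f.
  move=> r; apply: differentiable_continuous; apply/derivable1_diffP.
  by case: (df r).
rewrite /Rintegral -(integral_itv_bndoo true false); last first.
  by have /integrableP[] := continuous_itv_integrable cgw.
rewrite (@continuous_FTC2 _ _ f)//.
  split; first by move=> r _; case: (df r).
    exact/cvg_at_right_filter/cf.
  exact/cvg_at_left_filter/cf.
by move=> r _; rewrite derive1E; case: (df r).
Qed.

(** As [D] has mass 1, the difference is the integral of [(h r - c) * D r], and only points where
    [D] is nonzero count. This recovers endpoint values from the derivative of the cutoff. *)
Lemma bump_integral_near h (D : R -> R) s t (c e : R) :
  {within `[s, t], continuous h} ->
  continuous D -> (forall r, 0 <= D r) ->
  \int[mu]_(r in `]s, t[) D r = 1 ->
  (forall r, r \in `]s, t[ -> D r != 0 -> `|h r - c| <= e) ->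
  `|\int[mu]_(r in `]s, t[) (h r * D r) - c| <= e.
Proof.
move=> ch cD D0 D1 hc.
have cDw : {within `[s, t], continuous D} by exact: continuous_subspaceT.
have iD := continuous_itv_integrable cDw.
have ihD : mu.-integrable `]s, t[ (EFin \o (fun r => h r * D r)).
  by apply: integrable_mul_continuous => //; exact: continuous_itv_integrable.
have icD : mu.-integrable `]s, t[ (EFin \o (fun r => c * D r)).
  by apply: integrable_mul_continuous => //; apply: continuous_itv_integrable;
     apply: continuous_subspaceT; exact: cst_continuous.
have -> : c = \int[mu]_(r in `]s, t[) (c * D r) by rewrite RintegralZl// D1 mulr1.
rewrite -RintegralB//.
have iB : mu.-integrable `]s, t[ (EFin \o (fun r => h r * D r - c * D r)).
  exact: integrable_EFinB.
apply: (le_trans (le_normr_Rintegral _ iB)) => //.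
rewrite -[e]mulr1 -D1 -RintegralZl//; apply: le_Rintegral => //.
- exact: integrable_norm iB.
- by apply: integrable_mul_continuous => //; apply: continuous_itv_integrable;
     apply: continuous_subspaceT; exact: cst_continuous.
move=> r rst; rewrite -mulrBl normrM (ger0_norm (D0 r)).
have [->|Dr] := eqVneq (D r) 0; first by rewrite !mulr0.
by rewrite ler_wpM2r// hc// inE.
Qed.

(* The cutoff equals 1 away from the endpoints and vanishes near them when
   [k * (t - s) >= 4]. *)
Definition cutoff (k s t r : R) : R :=
  smoothstep (k * r + (- (k * s) - 1)) + smoothstep (- k * r + (k * t - 1)) - 1.

(** The derivative of the cutoff is [cutoff_left] minus [cutoff_right]. For large [k] these are
    densities of mass 1 concentrated within [2 / k] of [s] and of [t]: approximate Dirac masses. *)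
Definition cutoff_left (k s r : R) : R := k * tent (k * r + (- (k * s) - 1)).

Definition cutoff_right (k t r : R) : R := k * tent (- k * r + (k * t - 1)).

Lemma continuous_affine_tent (a b : R) : continuous (fun r => tent (a * r + b)).
Proof.
move=> r; apply: (@continuous_comp _ _ _ (fun r => a * r + b) (@tent R)).
  by apply: cvgD; [apply: cvgMr|exact: cvg_cst].
exact: continuous_tent.
Qed.

Lemma continuous_cutoff_left k s : continuous (cutoff_left k s).
Proof. by move=> r; apply: cvgMr; exact: continuous_affine_tent. Qed.

Lemma continuous_cutoff_right k t : continuous (cutoff_right k t).
Proof. by move=> r; apply: cvgMr; exact: continuous_affine_tent. Qed.

Lemma is_derive_cutoff k s t (r : R) :
  is_derive r 1 (cutoff k s t) (cutoff_left k s r - cutoff_right k t r).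
Proof.
have H1 := is_derive_affine_smoothstep k (- (k * s) - 1) r.
have H2 := is_derive_affine_smoothstep (- k) (k * t - 1) r.
rewrite /cutoff; apply: is_derive_eq.
by rewrite /cutoff_left /cutoff_right subr0 mulNr.
Qed.

Lemma cutoff_norm_le1 k s t r : `|cutoff k s t r| <= 1.
Proof.
rewrite /cutoff.
have := smoothstep_itv (k * r + (- (k * s) - 1)).
have := smoothstep_itv (- k * r + (k * t - 1)).
by move=> /andP[? ?] /andP[? ?]; rewrite ler_norml; apply/andP; split; lra.
Qed.

Section Cutoff.
Variables (k s t : R).
Hypothesis k_large : 4 <= k * (t - s).

Lemma cutoff_eq0 r : 0 < k -> ~ `[s + k^-1, t - k^-1]%classic r -> cutoff k s t r = 0.
Proof.
move=> k0; rewrite /= in_itv /= => /negP; rewrite negb_and -!ltNge /cutoff.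
have kk : k * k^-1 = 1 by rewrite divff// gt_eqF.
move=> /orP[]; rewrite -(ltr_pM2l k0) ?mulrDr ?mulrBr ?mulrN kk => H.
  rewrite smoothstep_le0 ?smoothstep_ge1; [lra| |]; move: k_large; lra.
rewrite smoothstep_ge1 ?smoothstep_le0; [lra| |]; move: k_large; lra.
Qed.

Lemma Rintegral_cutoff_left : 0 < k -> s < t ->
  \int[mu]_(r in `]s, t[) cutoff_left k s r = 1.
Proof.
move=> k0 st; rewrite (@Rintegral_derive _ _ _ _ st
  (is_derive_affine_smoothstep k (- (k * s) - 1))).
  rewrite smoothstep_ge1 ?smoothstep_le0 ?subr0//; move: k_large; lra.
exact: continuous_cutoff_left.
Qed.

Lemma Rintegral_cutoff_right : 0 < k -> s < t ->
  \int[mu]_(r in `]s, t[) cutoff_right k t r = 1.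
Proof.
move=> k0 st; have H (r : R) : is_derive r 1
    (fun r => - smoothstep (- k * r + (k * t - 1))) (cutoff_right k t r).
  have H2 := is_derive_affine_smoothstep (- k) (k * t - 1) r.
  by apply: is_derive_eq; rewrite /cutoff_right mulNr opprK.
rewrite (Rintegral_derive st H); last exact: continuous_cutoff_right.
rewrite smoothstep_le0 ?smoothstep_ge1 ?oppr0 ?sub0r ?opprK//; move: k_large; lra.
Qed.

End Cutoff.

Lemma cutoff_test_function (phi : R -> R) k s t : 0 < k -> 4 <= k * (t - s) ->
  (forall r : R, derivable phi r 1) -> continuous (phi^`())%classic ->
  test_function s t (fun r => phi r * cutoff k s t r) /\
  ((fun r => phi r * cutoff k s t r)^`())%classic =
   (fun r => (phi^`())%classic r * cutoff k s t r +
      phi r * (cutoff_left k s r - cutoff_right k t r)).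
Proof.
move=> k0 kst dphi cphi.
have dE (r : R) : is_derive r 1 (fun r => phi r * cutoff k s t r)
   ((phi^`())%classic r * cutoff k s t r + phi r * (cutoff_left k s r - cutoff_right k t r)).
  have H1 : is_derive r 1 phi (phi^`()%classic r).
    by rewrite derive1E; apply: derivableP; exact: dphi.
  have H2 := is_derive_cutoff k s t r.
  have H := is_deriveM H1 H2.
  by apply: is_derive_eq; rewrite /GRing.scale /= addrC mulrC.
have E : ((fun r => phi r * cutoff k s t r)^`())%classic =
   (fun r => (phi^`())%classic r * cutoff k s t r +
      phi r * (cutoff_left k s r - cutoff_right k t r)).
  by apply/funext => r; rewrite derive1E; case: (dE r).
have cph : continuous phi.
  by move=> r; apply: differentiable_continuous; apply/derivable1_diffP.
have cch : continuous (cutoff k s t).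
  move=> r; apply: differentiable_continuous; apply/derivable1_diffP.
  by case: (is_derive_cutoff k s t r).
split => //; split.
- by move=> r; case: (dE r).
- rewrite E => r; apply: cvgD; apply: cvgM.
  + exact: cphi.
  + exact: cch.
  + exact: cph.
  + by apply: cvgB; [exact: continuous_cutoff_left|exact: continuous_cutoff_right].
- exists `[s + k^-1, t - k^-1]%classic; split.
  + exact: segment_compact.
  + have ki : 0 < k^-1 by rewrite invr_gt0.
    by move=> r /=; rewrite !in_itv /= => /andP[? ?]; apply/andP; split; lra.
  + by move=> r H; rewrite cutoff_eq0// mulr0.
Qed.

(** [phi] need not vanish at the endpoints, so it is multiplied by a cutoff and the cutoff is sent
    to 1. The terms carrying the derivative of the cutoff converge to boundary values because
    [f * phi] is continuous up to the endpoints; the others converge by domination. *)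
Lemma weak_derivative_by_parts f w phi s t : s < t ->
  {within `[s, t], continuous f} ->
  mu.-integrable `]s, t[ (EFin \o w) ->
  weak_derivative s t f w ->
  (forall r : R, derivable phi r 1) -> continuous (phi^`())%classic ->
  \int[mu]_(r in `]s, t[) (f r * (phi^`())%classic r) =
    f t * phi t - f s * phi s - \int[mu]_(r in `]s, t[) (w r * phi r).
Proof.
move=> st cf iw wd dphi cdphi.
have cph : continuous phi.
  by move=> r; apply: differentiable_continuous; apply/derivable1_diffP.
have cphw : {within `[s, t], continuous phi} by exact: continuous_subspaceT.
have cdw : {within `[s, t], continuous (phi^`())%classic} by exact: continuous_subspaceT.
have iff := continuous_itv_integrable cf.
pose h r := f r * phi r.
have chw : {within `[s, t], continuous h}.
  by move=> r; apply: cvgM; [exact: cf|exact: cphw].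
have ifd : mu.-integrable `]s, t[ (EFin \o (fun r => f r * (phi^`())%classic r)).
  exact: integrable_mul_continuous.
have iwp : mu.-integrable `]s, t[ (EFin \o (fun r => w r * phi r)).
  exact: integrable_mul_continuous.
pose G r := f r * (phi^`())%classic r + w r * phi r.
have iG : mu.-integrable `]s, t[ (EFin \o G) by exact: integrable_EFinD.
suff IG : \int[mu]_(r in `]s, t[) G r = h t - h s.
  by apply/eqP; rewrite eq_sym subr_eq -/(h t) -/(h s) -IG RintegralD.
(* Multiples of [4 / (t - s)], so that [4 <= k n * (t - s)] holds for every [n], including 0. *)
pose k (n : nat) : R := n.+1%:R * (4 / (t - s)).
have ts0 : 0 < t - s by rewrite subr_gt0.
have k0 n : 0 < k n by rewrite mulr_gt0 ?ltr0n// divr_gt0.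
have k4 n : 4 <= k n * (t - s).
  rewrite /k -mulrA divfK ?gt_eqF// ler_peMl// ler1n//.
pose chi n := cutoff (k n) s t.
have cchi n : {within `[s, t], continuous (chi n)}.
  apply: continuous_subspaceT => r; apply: differentiable_continuous.
  by apply/derivable1_diffP; case: (is_derive_cutoff (k n) s t r).
(* The weak derivative tested against [phi * chi n], with the terms regrouped. *)
have key n : \int[mu]_(r in `]s, t[) (G r * chi n r) =
    \int[mu]_(r in `]s, t[) (h r * cutoff_right (k n) t r) -
    \int[mu]_(r in `]s, t[) (h r * cutoff_left (k n) s r).
  have [tf dE] := cutoff_test_function (k0 n) (k4 n) dphi cdphi.
  have := wd _ tf; rewrite dE => wdE.
  have ihl : mu.-integrable `]s, t[ (EFin \o (fun r => h r * cutoff_left (k n) s r)).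
    apply: integrable_mul_continuous; first exact: continuous_itv_integrable.
    by apply: continuous_subspaceT; exact: continuous_cutoff_left.
  have ihr : mu.-integrable `]s, t[ (EFin \o (fun r => h r * cutoff_right (k n) t r)).
    apply: integrable_mul_continuous; first exact: continuous_itv_integrable.
    by apply: continuous_subspaceT; exact: continuous_cutoff_right.
  have i1 : mu.-integrable `]s, t[ (EFin \o (fun r => f r * (phi^`())%classic r * chi n r)).
    exact: integrable_mul_continuous.
  have i2 : mu.-integrable `]s, t[ (EFin \o (fun r => w r * phi r * chi n r)).
    exact: integrable_mul_continuous.
  move: wdE.
  under eq_Rintegral => r _.
    rewrite (_ : f r * _ = f r * (phi^`())%classic r * chi n r +
      (h r * cutoff_left (k n) s r - h r * cutoff_right (k n) t r)); last first.
      by rewrite /h /chi; ring.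
    over.
  rewrite RintegralD//; last exact: integrable_EFinB.
  rewrite RintegralB//.
  under [X in _ = - X]eq_Rintegral do rewrite mulrA.
  under [X in _ -> X = _]eq_Rintegral do rewrite mulrDl.
  rewrite RintegralD//; lra.
have kinf (M : R) : \forall n \near \oo, M <= k n.
  have c0 : 0 < 4 / (t - s) by rewrite divr_gt0.
  near=> n.
  have : M / (4 / (t - s)) <= n%:R by near: n; exact: nbhs_infty_ger.
  rewrite ler_pdivrMr// => /le_trans; apply.
  by rewrite /k ler_wpM2r ?ler_nat// ltW.
have lim1 : \int[mu]_(r in `]s, t[) (G r * chi n r) @[n --> \oo] -->
    \int[mu]_(r in `]s, t[) G r.
  have iGc n : mu.-integrable `]s, t[ (EFin \o (fun r => G r * chi n r)).
    exact: integrable_mul_continuous.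
  have [|||||_ _ H] := @dominated_convergence _ _ _ mu `]s, t[%classic
     (measurable_itv _)
     (fun n r => (G r * chi n r)%:E) (EFin \o G) (abse \o (EFin \o G)).
  - by move=> n; case/integrableP : (iGc n).
  - by case/integrableP : iG.
  - apply: aeW => /= r; rewrite in_itv /= => /andP[sr rt].
    apply: cvg_near_cst; near=> n; congr (_%:E).
    have k1 : 2 / (r - s) <= k n by near: n; exact: kinf.
    have k2 : 2 / (t - r) <= k n by near: n; exact: kinf.
    rewrite !ler_pdivrMr ?subr_gt0// !mulrBr in k1 k2.
    rewrite /chi /cutoff !smoothstep_ge1; [|lra|lra].
    by rewrite addrK mulr1.
  - exact: integrable_abse.
  - apply: aeW => /= r n rst; rewrite -[leRHS]/(`|G r|%:E) lee_fin normrM ler_piMr//.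
    exact: cutoff_norm_le1.
  rewrite /Rintegral; apply: fine_cvg.
  by rewrite fineK//; exact: integrable_fin_num.
have lim2 : \int[mu]_(r in `]s, t[) (h r * cutoff_left (k n) s r) @[n --> \oo] --> h s.
  apply/cvgrPdist_le => e e0.
  have [|d d0 Hd] := within_continuous_dist (c := s) chw _ e0.
    by rewrite in_itv /= lexx ltW.
  near=> n; rewrite distrC; apply: bump_integral_near => //.
  - exact: continuous_cutoff_left.
  - by move=> r; rewrite mulr_ge0 ?tent_ge0// ltW.
  - exact: Rintegral_cutoff_left.
  have kd : 2 / d <= k n by near: n; exact: kinf.
  rewrite ler_pdivrMr// in kd.
  move=> r; rewrite in_itv /= => /andP[sr rt] Dr; rewrite distrC ltW// Hd//.
    by rewrite in_itv /= !ltW.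
  rewrite distrC gtr0_norm ?subr_gt0// ltNge; apply: contra Dr => dr.
  rewrite /cutoff_left tent_ge1 ?mulr0//.
  have : k n * d <= k n * (r - s) by rewrite ler_wpM2l// ltW.
  rewrite mulrBr; lra.
have lim3 : \int[mu]_(r in `]s, t[) (h r * cutoff_right (k n) t r) @[n --> \oo] --> h t.
  apply/cvgrPdist_le => e e0.
  have [|d d0 Hd] := within_continuous_dist (c := t) chw _ e0.
    by rewrite in_itv /= lexx ltW.
  near=> n; rewrite distrC; apply: bump_integral_near => //.
  - exact: continuous_cutoff_right.
  - by move=> r; rewrite mulr_ge0 ?tent_ge0// ltW.
  - exact: Rintegral_cutoff_right.
  have kd : 2 / d <= k n by near: n; exact: kinf.
  rewrite ler_pdivrMr// in kd.
  move=> r; rewrite in_itv /= => /andP[sr rt] Dr; rewrite distrC ltW// Hd//.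
    by rewrite in_itv /= !ltW.
  rewrite gtr0_norm ?subr_gt0// ltNge; apply: contra Dr => dr.
  rewrite /cutoff_right tent_ge1 ?mulr0//.
  have : k n * d <= k n * (t - r) by rewrite ler_wpM2l// ltW.
  rewrite mulrBr; lra.
have lim4 : \int[mu]_(r in `]s, t[) (G r * chi n r) @[n --> \oo] --> h t - h s.
  by under eq_fun do rewrite key; exact: cvgB.
exact: (cvg_unique (@norm_hausdorff _ _) lim1 lim4).
Unshelve. all: by end_near. Qed.

End Intervals.

(** * Splitting and extending Sobolev functions *)

Section Splitting.
Variable R : realType.
Implicit Types (f g w phi : R -> R) (s t u a b : R).
Notation mu := (@lebesgue_measure R).

Lemma measurable_fun_itv_split (f : R -> \bar R) s t u : s < t -> t < u ->
  measurable_fun `]s, t[ f -> measurable_fun `]t, u[ f ->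
  measurable_fun `]s, u[ f.
Proof.
move=> st tu m1 m2; rewrite (@itv_bndbnd_setU _ _ _ (BRight t)); last 2 first.
- by rewrite bnd_simp ltW.
- by rewrite bnd_simp.
apply/measurable_funU => //; split => //.
by apply/emeasurable_fun_itv_bndo_bndcP.
Qed.

Lemma integral_itv_split (f : R -> \bar R) s t u : s < t -> t < u ->
  measurable_fun `]s, u[ f ->
  (\int[mu]_(r in `]s, u[) f r =
   \int[mu]_(r in `]s, t[) f r + \int[mu]_(r in `]t, u[) f r)%E.
Proof.
move=> st tu mf.
have mst : measurable_fun `]s, t[ f.
  by apply: measurable_funS mf => //; apply: subset_itvl; rewrite bnd_simp ltW.
have E : `]s, u[%classic = `]s, t]%classic `|` `]t, u[%classic.
  by rewrite (@itv_bndbnd_setU _ _ _ (BRight t)) // bnd_simp// ltW.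
rewrite -(integral_itv_bndoo false false mst) E integral_setU// -?E//.
apply/disj_setPS => y [/=]; rewrite 2!in_itv/= => /andP[_ yx] /andP[].
by rewrite ltNge yx.
Qed.

Lemma integrable_itv_split f s t u : s < t -> t < u ->
  mu.-integrable `]s, t[ (EFin \o f) -> mu.-integrable `]t, u[ (EFin \o f) ->
  mu.-integrable `]s, u[ (EFin \o f).
Proof.
move=> st tu /integrableP[m1 i1] /integrableP[m2 i2].
have m := measurable_fun_itv_split st tu m1 m2.
apply/integrableP; split => //.
rewrite (integral_itv_split st tu); last by apply: measurableT_comp m.
exact: lte_add_pinfty.
Qed.

Lemma Rintegral_itv_split f s t u : s < t -> t < u ->
  mu.-integrable `]s, u[ (EFin \o f) ->
  \int[mu]_(r in `]s, u[) f r =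
   \int[mu]_(r in `]s, t[) f r + \int[mu]_(r in `]t, u[) f r.
Proof.
move=> st tu intf; rewrite /Rintegral (integral_itv_split st tu); last first.
  by case/integrableP : intf.
rewrite fineD//; apply: integrable_fin_num => //; apply: integrableS intf => //.
- by apply: subset_itvl; rewrite bnd_simp ltW.
- by apply: subset_itvr; rewrite bnd_simp ltW.
Qed.

(** The support is closed, so [phi] vanishes on a whole neighbourhood of [r], even when [r] is an
    endpoint; hence its derivative vanishes there as well. *)
Lemma test_function_out phi s t r : test_function s t phi -> r \notin `]s, t[ ->
  phi r = 0 /\ (phi^`())%classic r = 0.
Proof.
move=> [_ _ [K [cK Kst K0]]] rst.
have nKr : ~ K r by move=> /Kst; apply/negP.
split; first exact: K0.
rewrite derive1E.
have -> : 'D_1 phi r = 'D_1 (cst 0) r; last by rewrite derive_val.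
apply: near_eq_derive.
have : nbhs r (~` K).
  apply: open_nbhs_nbhs; split => //.
  by apply: closed_openC; apply: compact_closed => //; exact: norm_hausdorff.
by apply: filterS => y /K0.
Qed.

Lemma test_functionW phi s t a b : s <= a -> b <= t ->
  test_function a b phi -> test_function s t phi.
Proof.
move=> sa bt [? ? [K [cK Kab K0]]]; split => //; exists K; split => //.
by apply: subset_trans Kab _; apply: subset_itv; rewrite bnd_simp.
Qed.

Lemma weak_derivative_sub f w s t a b : s <= a -> b <= t ->
  weak_derivative s t f w -> weak_derivative a b f w.
Proof.
move=> sa bt H phi tphi; have := H phi (test_functionW sa bt tphi).
have E (F : R -> R) : (forall r, r \notin `]a, b[ -> F r = 0) ->
    \int[mu]_(r in `]s, t[) F r = \int[mu]_(r in `]a, b[) F r.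
  move=> F0; rewrite Rintegral_mkcond [RHS]Rintegral_mkcond.
  congr Rintegral; apply/funext => r; rewrite !patchE !mem_setE.
  case: ifPn => rst; case: ifPn => rab //; first exact: F0.
  case/negP: rst; move: rab; rewrite !in_itv /= => /andP[? ?].
  by apply/andP; split; [exact: le_lt_trans sa _|exact: lt_le_trans bt].
by rewrite !E// => r /(test_function_out tphi)[p0 p1]; rewrite ?p0 ?p1 mulr0.
Qed.

(** Integration by parts against the constant 1, which is not a test function; this is where the
    boundary terms are essential. *)
Lemma weak_derivative_FTC f w s t a b : s <= a -> a < b -> b <= t ->
  {within `[s, t], continuous f} ->
  mu.-integrable `]s, t[ (EFin \o w) -> weak_derivative s t f w ->
  \int[mu]_(r in `]a, b[) w r = f b - f a.
Proof.
move=> sa ab bt cf iw wd.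
have sub : `[a, b]%classic `<=` `[s, t]%classic by apply: subset_itv; rewrite bnd_simp.
have d1 (r : R) : is_derive r 1 (cst 1 : R -> R) 0 by exact: is_derive_cst.
have E : ((cst 1 : R -> R)^`())%classic = cst 0.
  by apply/funext => r; rewrite derive1E derive_val.
have := @weak_derivative_by_parts R f w (cst 1) a b ab.
move=> /(_ (continuous_subspaceW sub cf)).
have iw' : mu.-integrable `]a, b[ (EFin \o w).
  by apply: integrableS iw => //; apply: subset_itv; rewrite bnd_simp.
move=> /(_ iw' (weak_derivative_sub sa bt wd)).
rewrite E; move=> H.
have {H} := H (fun r => derivable_cst _ _ _) (@cst_continuous _ _ _).
under eq_Rintegral do rewrite mulr0.
under [X in _ - X]eq_Rintegral do rewrite mulr1.
rewrite Rintegral_cst//= mul0r !mulr1; lra.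
Qed.

(** A test function on the long interval may be nonzero at the junction [t]. Each half then
    contributes a boundary term [f t * phi t], and the two cancel because the extension is
    continuous there. *)
Lemma weak_derivative_extend f w (v : R) t u : 0 < t -> t < u ->
  {within `[0, t], continuous f} ->
  mu.-integrable `]0, t[ (EFin \o w) -> weak_derivative 0 t f w ->
  {within `[0, u], continuous (fun r => f (Num.min r t) + (Num.max r t - t) * v)} ->
  mu.-integrable `]0, u[ (EFin \o (fun r => if r < t then w r else v)) /\
  weak_derivative 0 u (fun r => f (Num.min r t) + (Num.max r t - t) * v)
    (fun r => if r < t then w r else v).
Proof.
move=> t0 tu cf iw wd cF.
set F := fun r => f (Num.min r t) + (Num.max r t - t) * v.
set W := fun r => if r < t then w r else v.
have Fl r : r \in `]0, t[%classic -> F r = f r.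
  rewrite inE /= in_itv /= => /andP[r0 rt]; rewrite /F min_l ?max_r ?ltW//.
  by rewrite subrr mul0r addr0.
have Fr r : r \in `]t, u[%classic -> F r = f t + (r - t) * v.
  by rewrite inE /= in_itv /= => /andP[tr ru]; rewrite /F min_r ?max_l ?ltW.
have Wl r : r \in `]0, t[%classic -> W r = w r.
  by rewrite inE /= in_itv /= => /andP[r0 rt]; rewrite /W rt.
have Wr r : r \in `]t, u[%classic -> W r = v.
  by rewrite inE /= in_itv /= => /andP[tr ru]; rewrite /W ltNge ltW.
have iWl : mu.-integrable `]0, t[ (EFin \o W).
  apply: eq_integrable iw => // r rt; congr (_%:E).
  by rewrite Wl.
have iWr : mu.-integrable `]t, u[ (EFin \o W).
  apply: (@eq_integrable _ _ _ _ _ _ (EFin \o cst v)) => //.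
    by move=> r rt; congr (_%:E); rewrite Wr.
  by apply: continuous_itv_integrable; apply: continuous_subspaceT; exact: cst_continuous.
have iW := integrable_itv_split t0 tu iWl iWr.
split => // phi tphi; have [dphi cdphi _] := tphi.
have cphi : continuous phi.
  by move=> r; apply: differentiable_continuous; apply/derivable1_diffP.
have iF : mu.-integrable `]0, u[ (EFin \o (fun r => F r * (phi^`())%classic r)).
  apply: integrable_mul_continuous; first exact: continuous_itv_integrable.
  exact: continuous_subspaceT.
have iWp : mu.-integrable `]0, u[ (EFin \o (fun r => W r * phi r)).
  by apply: integrable_mul_continuous => //; exact: continuous_subspaceT.
rewrite (Rintegral_itv_split t0 tu iF) (Rintegral_itv_split t0 tu iWp).
have [p0 _] : phi 0 = 0 /\ (phi^`())%classic 0 = 0.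
  by apply: (test_function_out tphi); rewrite in_itv /= ltxx.
have [pu _] : phi u = 0 /\ (phi^`())%classic u = 0.
  by apply: (test_function_out tphi); rewrite in_itv /= ltxx andbF.
have -> : \int[mu]_(r in `]0, t[) (F r * (phi^`())%classic r) =
   f t * phi t - \int[mu]_(r in `]0, t[) (W r * phi r).
  rewrite (@eq_Rintegral _ _ _ mu _ (fun r => f r * (phi^`())%classic r)); last first.
    by move=> r rt; rewrite Fl.
  rewrite (weak_derivative_by_parts t0 cf iw wd dphi cdphi) p0 mulr0 subr0.
  by congr (_ - _); apply: eq_Rintegral => r rt; rewrite Wl.
have -> : \int[mu]_(r in `]t, u[) (F r * (phi^`())%classic r) =
   - (f t * phi t) - \int[mu]_(r in `]t, u[) (W r * phi r).
  rewrite (@eq_Rintegral _ _ _ mu _ (fun r => (f t + (r - t) * v) * (phi^`())%classic r)); last first.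
    by move=> r rt; rewrite Fr.
  rewrite [X in _ = _ - X](@eq_Rintegral _ _ _ mu _ (fun r => v * phi r)); last first.
    by move=> r rt; rewrite Wr.
  have dG (r : R) : is_derive r 1 (fun r => (f t + (r - t) * v) * phi r)
      ((f t + (r - t) * v) * (phi^`())%classic r + v * phi r).
    have H1 : is_derive r 1 phi ((phi^`())%classic r).
      by rewrite derive1E; apply: derivableP; exact: dphi.
    have H2 : is_derive r 1 (fun r => f t + (r - t) * v) v.
      apply: is_derive_eq; rewrite /GRing.scale /=; ring.
    have H := is_deriveM H2 H1.
    by apply: is_derive_eq; rewrite /GRing.scale /= [phi r * v]mulrC.
  have caff : continuous (fun r => f t + (r - t) * v).
    move=> r; apply: cvgD; first exact: cvg_cst.
    by apply: cvgMl; apply: cvgB => //; exact: cvg_cst.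
  have cg : continuous (fun r => (f t + (r - t) * v) * (phi^`())%classic r + v * phi r).
    move=> r; apply: cvgD; first by apply: cvgM; [exact: caff|exact: cdphi].
    by apply: cvgMr; exact: cphi.
  have := Rintegral_derive tu dG cg.
  rewrite RintegralD//.
  - rewrite pu mulr0 subrr mul0r addr0 sub0r; lra.
  - apply: continuous_itv_integrable; apply: continuous_subspaceT => r.
    by apply: cvgM; [exact: caff|exact: cdphi].
  - apply: continuous_itv_integrable; apply: continuous_subspaceT => r.
    by apply: cvgMr; exact: cphi.
lra.
Qed.

End Splitting.

(** * Admissible curves *)

Section Curves.
Variables (R : realType) (m : nat).
Let V := 'rV[R]_m.+1.
Notation mu := (@lebesgue_measure R).
Implicit Types (x y p v : V) (s t u a b : R) (c : (R -> V) * (R -> V)).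

Lemma within_continuous_coord (A : set R) (xi : R -> V) i :
  {within A, continuous xi} -> {within A, continuous (fun r => xi r 0 i)}.
Proof.
move=> cx r; apply: (@cvg_comp _ _ _ xi (fun z : V => z 0 i) _ (nbhs (xi r))).
  exact: cx.
exact: coord_continuous.
Qed.

Lemma within_continuous_itv (W : normedModType R) (f : R -> W) s t :
  (forall a (e : R), a \in `[s, t] -> 0 < e -> exists2 d : R, 0 < d &
     forall r, r \in `[s, t] -> `|a - r| < d -> `|f a - f r| < e) ->
  {within `[s, t], continuous f}.
Proof.
move=> H; apply/subspace_continuousP => c cst; apply/cvgrPdist_lt => e e0.
have [d d0 Hd] := H c e cst e0.
rewrite near_withinE; apply/nbhs_ballP; exists d => // r.
by rewrite -ball_normE /= => cr rst; apply: Hd.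
Qed.

(** The curve [c] up to time [t], then uniform motion with velocity [v]. The truncations by
    [Num.min] and [Num.max] give the position by a single formula, so continuity requires no
    gluing. *)
Definition extend_curve t v c : (R -> V) * (R -> V) :=
  (fun r => c.1 (Num.min r t) + (Num.max r t - t) *: v,
   fun r => if r < t then c.2 r else v).

Lemma extend_curve_continuous t u v c : 0 < t -> t < u ->
  {within `[0, t], continuous c.1} ->
  {within `[0, u], continuous (extend_curve t v c).1}.
Proof.
move=> t0 tu cc; apply: within_continuous_itv => /= a e; rewrite in_itv /= => /andP[a0 au] e0.
have mint r : 0 <= r -> Num.min r t \in `[0, t].
  by move=> r0; rewrite in_itv /= le_min r0 ltW//= ge_min lexx orbT.
have [|d d0 Hd] := within_continuous_dist cc (mint a a0) (_ : 0 < e / 2).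
  by rewrite divr_gt0.
have v0 : 0 < `|v| + 1 by rewrite ltr_wpDl.
exists (Num.min d (e / 2 / (`|v| + 1))).
  by rewrite lt_min d0 /= !divr_gt0.
move=> r; rewrite in_itv /= => /andP[r0 ru]; rewrite lt_min => /andP[ard are].
rewrite opprD addrACA -scalerBl opprB addrA subrK.
rewrite (splitr e); apply: (le_lt_trans (ler_normD _ _)); apply: ltr_leD.
  apply: Hd; first exact: mint.
  apply: le_lt_trans ard; rewrite /Num.min.
  case: ltP => ha; case: ltP => hr => //.
  - by rewrite !ler0_norm; lra.
  - by rewrite !ger0_norm; lra.
  - by rewrite subrr normr0.
rewrite normrZ; apply: (@le_trans _ _ (`|a - r| * (`|v| + 1))).
  rewrite ler_pM//; last by rewrite lerDl.
  rewrite /Num.max; case: ltP => ha; case: ltP => hr => //.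
  - by rewrite subrr normr0.
  - by rewrite !ler0_norm; lra.
  - by rewrite !ger0_norm; lra.
by rewrite ltW// -ltr_pdivlMr.
Qed.

Lemma extend_curve_W11 t u v c : 0 < t -> t < u ->
  W11 0 t c.1 c.2 -> W11 0 u (extend_curve t v c).1 (extend_curve t v c).2.
Proof.
move=> t0 tu [cc wc].
have cE := extend_curve_continuous (v := v) t0 tu cc.
split => // i.
have ci := within_continuous_coord (i := i) cE.
have [_ iw wd] := wc i.
have E1 : (fun r => (extend_curve t v c).1 r 0 i) =
    (fun r => c.1 (Num.min r t) 0 i + (Num.max r t - t) * v 0 i).
  by apply/funext => r; rewrite /= !mxE.
have E2 : (fun r => (extend_curve t v c).2 r 0 i) =
    (fun r => if r < t then c.2 r 0 i else v 0 i).
  by apply/funext => r /=; case: ifP.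
have [|iW wD] := @weak_derivative_extend R (fun r => c.1 r 0 i) (fun r => c.2 r 0 i)
  (v 0 i) t u t0 tu (within_continuous_coord (i := i) cc) iw wd.
  by rewrite -E1.
split; first exact: continuous_itv_integrable.
- by move: iW; rewrite -E2.
- by rewrite E1 E2.
Qed.

Lemma W11_sub s t a b (xi w : R -> V) : s <= a -> b <= t ->
  W11 s t xi w -> W11 a b xi w.
Proof.
move=> sa bt [cx wx].
have subc : `[a, b]%classic `<=` `[s, t]%classic by apply: subset_itv; rewrite bnd_simp.
have subo : `]a, b[%classic `<=` `]s, t[%classic by apply: subset_itv; rewrite bnd_simp.
split; first exact: continuous_subspaceW cx.
move=> i; have [ix iw wd] := wx i; split.
- by apply: integrableS ix.
- by apply: integrableS iw.
- exact: weak_derivative_sub wd.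
Qed.

Lemma constant_curve_W11 t y : 0 < t -> W11 0 t (cst y) (cst 0).
Proof.
move=> t0; split; first by apply: continuous_subspaceT; exact: cst_continuous.
have ic (k : R) : mu.-integrable `]0, t[ (EFin \o cst k).
  by apply: continuous_itv_integrable; apply: continuous_subspaceT; exact: cst_continuous.
move=> i; split; [exact: ic|exact: ic|].
move=> phi tphi; have [dphi cdphi _] := tphi.
have [p0 _] : phi 0 = 0 /\ (phi^`())%classic 0 = 0.
  by apply: (test_function_out tphi); rewrite in_itv /= ltxx.
have [pt _] : phi t = 0 /\ (phi^`())%classic t = 0.
  by apply: (test_function_out tphi); rewrite in_itv /= ltxx andbF.
rewrite RintegralZl//; last first.
  by apply: continuous_itv_integrable; exact: continuous_subspaceT.
have dE (r : R) : is_derive r 1 phi ((phi^`())%classic r).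
  by rewrite derive1E; apply: derivableP; exact: dphi.
rewrite (Rintegral_derive t0 dE cdphi).
under [X in _ = - X]eq_Rintegral do rewrite mxE mul0r.
rewrite Rintegral_cst//= mul0r oppr0.
by rewrite p0 pt subrr mulr0.
Qed.

Variable L : V -> V -> R.
Hypothesis L_cont : continuous (fun p : V * V => L p.1 p.2).

Lemma measurable_lagrangian_curve s t (xi w : R -> V) : W11 s t xi w ->
  measurable_fun `]s, t[ (fun r => L (xi r) (w r)).
Proof.
move=> [_ wx]; apply: measurable_lagrangian => // i; have [i1 i2 _] := wx i.
- by case/integrableP : i1 => /measurable_EFinP.
- by case/integrableP : i2 => /measurable_EFinP.
Qed.

Lemma actionE t c : W11 0 t c.1 c.2 ->
  action L t c = (\int[mu]_(r in `]0%R, t[) (L (c.1 r) (c.2 r))%:E)%E.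
Proof.
move=> wc; rewrite /action (integral_itv_bndoo true false)//.
by apply/measurable_EFinP; exact: measurable_lagrangian_curve.
Qed.

Variable c0 : R.
Hypothesis c0_ge0 : 0 <= c0.
Hypothesis L_lb : forall x v, - c0 <= L x v.

(** The lower bound [- c0] makes the negative part integrable on a bounded interval, so an action
    below [+oo] is finite and its integrand is integrable. *)
Lemma finite_action t c : W11 0 t c.1 c.2 -> (action L t c < +oo)%E ->
  mu.-integrable `]0, t[ (EFin \o (fun r => L (c.1 r) (c.2 r))) /\
  action L t c = (\int[mu]_(r in `]0%R, t[) L (c.1 r) (c.2 r))%:E.
Proof.
move=> wc; rewrite (actionE wc) => fin.
have mL : measurable_fun `]0, t[ (fun r => L (c.1 r) (c.2 r)).
  exact: measurable_lagrangian_curve.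
have mLE : measurable_fun `]0, t[ (EFin \o (fun r => L (c.1 r) (c.2 r))).
  exact/measurable_EFinP.
have ic : mu.-integrable `]0, t[ (EFin \o cst c0).
  by apply: continuous_itv_integrable; apply: continuous_subspaceT; exact: cst_continuous.
have fn : (\int[mu]_(r in `]0%R, t[) (L (c.1 r) (c.2 r))%:E)%E \is a fin_num.
  rewrite fin_numElt fin andbT integralE.
  have n1 : (\int[mu]_(r in `]0%R, t[) ((EFin \o (fun r => L (c.1 r) (c.2 r)))^\- r) < +oo)%E.
    apply: le_lt_trans (integrable_lty _ ic) => //.
    apply: ge0_le_integral => //.
    - exact: measurable_funeneg.
    - by case/integrableP : ic.
    - move=> r _; rewrite funenegE ge_max; apply/andP; split.
        by rewrite /= lee_fin lerNl.
      by rewrite lee_fin.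
  rewrite ltNye adde_eq_ninfty negb_or -!ltNye; apply/andP; split.
    by apply: lt_le_trans (integral_ge0 _ _) => //; exact: ltNyr.
  by rewrite lteNr.
have it : mu.-integrable `]0, t[ (EFin \o (fun r => L (c.1 r) (c.2 r))).
  apply/integrableP; split => //.
  by rewrite /= integral_fin_num_abs.
by split => //; rewrite /Rintegral fineK.
Qed.

Lemma action_gtNy t c : W11 0 t c.1 c.2 -> (-oo < action L t c)%E.
Proof.
move=> wc; have [fin|] := ltP (action L t c) +oo%E.
  by have [_ ->] := finite_action wc fin; rewrite ltNyr.
by rewrite leye_eq => /eqP ->.
Qed.

Variable Omega : set V.

Lemma extend_curve_Gamma t tau y p v c : 0 < t -> 0 < tau ->
  Gamma Omega 0 t y p c ->
  (forall s, 0 <= s <= tau -> closure Omega (p + s *: v)) ->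
  Gamma Omega 0 (t + tau) y (p + tau *: v) (extend_curve t v c).
Proof.
move=> t0 tau0 [wc cO cy cp] seg; have tu : t < t + tau by rewrite ltrDl.
split.
- exact: extend_curve_W11.
- move=> r; rewrite in_itv /= => /andP[r0 ru].
  have [rt|tr] := leP r t.
    rewrite subrr scale0r addr0; apply: cO.
    by rewrite in_itv /= r0.
  by rewrite cp; apply: seg; apply/andP; split; lra.
- by rewrite /= min_l ?max_r ?subrr ?scale0r ?addr0// ltW.
- by rewrite /= min_r ?max_l ?ltW// cp [t + tau - t]addrC addKr.
Qed.

Lemma extend_curve_action t tau y p v c M : 0 < t -> 0 < tau ->
  Gamma Omega 0 t y p c ->
  (forall s, 0 <= s <= tau -> L (p + s *: v) v <= M) ->
  (action L (t + tau) (extend_curve t v c) <= action L t c + (tau * M)%:E)%E.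
Proof.
move=> t0 tau0 [wc cO cy cp] LM; have tu : t < t + tau by rewrite ltrDl.
have wE := extend_curve_W11 v t0 tu wc.
rewrite (actionE wE) (actionE wc).
rewrite (integral_itv_split t0 tu); last first.
  by apply/measurable_EFinP; exact: measurable_lagrangian_curve.
apply: leeD.
  rewrite le_eqVlt; apply/orP; left; apply/eqP; apply: eq_integral => r.
  rewrite inE /= in_itv /= => /andP[r0 rt].
  by rewrite rt min_l ?max_r ?ltW// subrr scale0r addr0.
rewrite (@eq_integral _ _ _ mu _ (fun r : R => (L (p + (r - t) *: v) v)%:E)); last first.
  move=> r; rewrite inE /= in_itv /= => /andP[tr ru].
  by rewrite ltNge (ltW tr) /= min_r ?max_l ?ltW// cp.
apply: (@le_trans _ _ (\int[mu]_(r in `]t, (t + tau)%R[) cst M%:E r)%E).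
  apply: le_integral => //.
  - apply: (@continuous_itv_integrable _ (fun r => L (p + (r - t) *: v) v)).
    apply: continuous_subspaceT => r.
    apply: (@continuous_comp _ _ _ (fun r => (p + (r - t) *: v, v) : V * V)
              (fun p : V * V => L p.1 p.2)); last exact: L_cont.
    have -> : (fun r : R => (p + (r - t) *: v, v) : V * V) =
        (fun r => (p, v) + (r - t) *: ((v, 0) : V * V)).
      by apply/funext => q; congr pair; rewrite /= scaler0 addr0.
    apply: cvgD; first exact: cvg_cst.
    by apply: cvgZr_tmp; apply: cvgB => //; exact: cvg_cst.
  - by apply: continuous_itv_integrable; apply: continuous_subspaceT; exact: cst_continuous.
  move=> r; rewrite inE /= in_itv /= => /andP[tr ru]; rewrite lee_fin; apply: LM.
  by apply/andP; split; lra.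
rewrite integral_cst//= lebesgue_measure_itv /= lte_fin tu.
by rewrite -EFinB -EFinM lee_fin mulrC [t + tau - t]addrC addKr.
Qed.

Lemma constant_curve_Gamma t y : 0 < t -> closure Omega y ->
  Gamma Omega 0 t y y (cst y, cst 0).
Proof. by move=> t0 Oy; split => //; exact: constant_curve_W11. Qed.

Lemma constant_curve_action t y : 0 < t ->
  action L t (cst y, cst 0) = (t * L y 0)%:E.
Proof.
move=> t0; rewrite /action /= integral_cst//= lebesgue_measure_itv /= lte_fin t0.
by rewrite -EFinB -EFinM subr0 mulrC.
Qed.

Lemma restrict_curve_Gamma t a y p c : 0 < a -> a <= t ->
  Gamma Omega 0 t y p c -> Gamma Omega 0 a y (c.1 a) c.
Proof.
move=> a0 at_ [wc cO cy cp]; split => //.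
  exact: W11_sub wc.
move=> r; rewrite in_itv /= => /andP[r0 ra]; apply: cO.
by rewrite in_itv /= r0 (le_trans ra).
Qed.

End Curves.

(** * Growth of the Lagrangian and lower bounds on short time steps *)

Section Enorm.
Variables (R : realType) (m : nat).
Implicit Types v w : 'rV[R]_m.+1.

Lemma enorm_sqr v : enorm v ^+ 2 = \sum_(i < m.+1) v 0 i ^+ 2.
Proof. by rewrite sqr_sqrtr// sumr_ge0// => i _; rewrite sqr_ge0. Qed.

Lemma enorm_ge0 v : 0 <= enorm v.
Proof. exact: sqrtr_ge0. Qed.

Lemma row_norm_le_enorm v : `|v| <= enorm v.
Proof.
apply: row_norm_le => [|j]; first exact: enorm_ge0.
rewrite -sqrtr_sqr ler_wsqrtr// (bigD1 j)//= lerDl sumr_ge0// => i _.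
exact: sqr_ge0.
Qed.

Lemma enorm_le_row_norm v : enorm v <= m.+1%:R * `|v|.
Proof.
rewrite -(@ler_pXn2r _ 2) ?nnegrE ?enorm_ge0// ?mulr_ge0//.
rewrite enorm_sqr exprMn; apply: (@le_trans _ _ (\sum_(i < m.+1) `|v| ^+ 2)).
  apply: ler_sum => i _; rewrite -(real_normK (num_real (v 0 i))).
  by rewrite lerXn2r ?nnegrE// row_norm_coord.
rewrite sumr_const card_ord -[leLHS]mulr_natl ler_wpM2r ?sqr_ge0//.
by rewrite expr2 -natrM ler_nat leq_pmulr.
Qed.

(** A weak triangle inequality, squared and up to a factor; the room between [rho / 8] and [rho]
    absorbs the loss. *)
Lemma enormD_sqr_le v w : enorm (v + w) ^+ 2 <= 2 * (enorm v ^+ 2 + enorm w ^+ 2).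
Proof.
rewrite !enorm_sqr -big_split mulr_sumr; apply: ler_sum => i _; rewrite !mxE /=.
have := sqr_ge0 (v 0 i - w 0 i); nra.
Qed.

Lemma enormZ (a : R) v : enorm (a *: v) = `|a| * enorm v.
Proof.
rewrite /enorm -sqrtr_sqr -sqrtrM ?sqr_ge0// mulr_sumr; congr Num.sqrt.
by apply: eq_bigr => i _; rewrite mxE exprMn.
Qed.

Lemma enormN v : enorm (- v) = enorm v.
Proof. by rewrite -scaleN1r enormZ normrN1 mul1r. Qed.

End Enorm.

Section Growth.
Variables (R : realType) (m : nat) (L : 'rV[R]_m.+1 -> 'rV[R]_m.+1 -> R).
Hypothesis L_tonelli : tonelli L.

Lemma tonelli_lower_bound :
  exists2 c0 : R, 0 <= c0 & forall x v, - c0 <= L x v.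
Proof.
have [_ _ [th1 [th2 [c0 [[t10 _ _] _ c00 H]]]]] := L_tonelli.
exists c0; first exact: ltW.
move=> x v; apply: le_trans (H x v).1.
by rewrite lerDr t10// enorm_ge0.
Qed.

(** Beyond some [r0] superlinearity gives [theta1 r >= M * r]; below it the constant [M * |r0|]
    absorbs the linear term. *)
Lemma tonelli_linear_growth (M : R) : 0 <= M ->
  exists2 C : R, 0 <= C & forall x v, M * `|v| - C <= L x v.
Proof.
move=> M0.
have [_ _ [th1 [th2 [c0 [[t10 _ tinf] _ c00 H]]]]] := L_tonelli.
have [r0 Hr] : exists r0 : R, forall r, r0 < r -> M <= th1 r / r.
  move/cvgryPge: tinf => /(_ M) [r0 [_ Hr]].
  by exists r0.
exists (M * `|r0| + c0); first by apply: addr_ge0; [exact: mulr_ge0|exact: ltW].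
move=> x v; apply: le_trans (H x v).1.
rewrite opprD addrA lerD2r.
apply: (@le_trans _ _ (M * enorm v - M * `|r0|)).
  by rewrite lerD2r ler_wpM2l// row_norm_le_enorm.
have [vr|rv] := leP (enorm v) `|r0|.
  apply: (@le_trans _ _ 0); last by rewrite t10// enorm_ge0.
  by rewrite subr_le0 ler_wpM2l.
have v0 : 0 < enorm v by exact: le_lt_trans (normr_ge0 _) rv.
have := Hr _ (le_lt_trans (ler_norm _) rv).
rewrite ler_pdivlMr// => Hm.
apply: le_trans Hm; rewrite lerBlDr lerDl; exact: mulr_ge0.
Qed.

Lemma tonelli_unit_bound :
  exists2 B : R, 0 <= B & forall x v, `|v| <= 1 -> L x v <= B.
Proof.
have [_ _ [th1 [th2 [c0 [_ [t20 t2m _] c00 H]]]]] := L_tonelli.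
exists (th2 m.+1%:R); first by rewrite t20.
move=> x v v1; apply: le_trans (H x v).2 _.
apply: t2m; first exact: enorm_ge0.
by apply: le_trans (enorm_le_row_norm v) _; rewrite ler_piMr.
Qed.

End Growth.

(** * Lower bounds for the action of one time step *)

Section Steps.
Variables (R : realType) (m : nat).
Let V := 'rV[R]_m.+1.
Notation mu := (@lebesgue_measure R).
Variable L : V -> V -> R.
Hypothesis L_C2 : is_C2 (fun p : V * V => L p.1 p.2).
Hypothesis L_pos : forall x v, posdefmx (hessian_v L x v).

(** Freezing the position at the start of a step costs an error affine in the speed. The penalty
    with weight [om] dominates it pointwise, and its integral over the whole curve is [om] times a
    fixed finite number. *)
Definition padded_lagrangian (om : R) (c : (R -> V) * (R -> V)) (r : R) : R :=
  L (c.1 r) (c.2 r) + om * (1 + \sum_j `|c.2 r 0 j|).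

Variables (t : R) (c : (R -> V) * (R -> V)).
Hypothesis W11c : W11 0 t c.1 c.2.
Hypothesis Lc_int :
  mu.-integrable `]0, t[ (EFin \o (fun r => L (c.1 r) (c.2 r))).

Let cst_int a b (k : R) : mu.-integrable `]a, b[ (EFin \o cst k).
Proof.
by apply: continuous_itv_integrable; apply: continuous_subspaceT; exact: cst_continuous.
Qed.

Let Z_int a b (k : R) (f : R -> R) : mu.-integrable `]a, b[ (EFin \o f) ->
  mu.-integrable `]a, b[ (EFin \o (fun r => k * f r)).
Proof. by move=> H; have := @integrableZl _ _ _ mu _ _ k _ H; exact. Qed.

Lemma sum_speed_integrable :
  mu.-integrable `]0, t[ (EFin \o (fun r => \sum_j `|c.2 r 0 j|)).
Proof.
have -> : EFin \o (fun r => \sum_j `|c.2 r 0 j|) =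
    (fun r => \sum_(j <- index_enum 'I_m.+1) (`|c.2 r 0 j|%:E))%E.
  by apply/funext => r; rewrite /= sumEFin.
apply: integrable_sum => // j _; case: W11c => _ /(_ j)[_ iw _].
exact: (integrable_norm iw).
Qed.

Lemma padded_lagrangian_integrable om :
  mu.-integrable `]0, t[ (EFin \o padded_lagrangian om c).
Proof.
apply: integrable_EFinD => //; apply: Z_int; apply: integrable_EFinD => //.
  exact: cst_int.
exact: sum_speed_integrable.
Qed.

Variables (a b : R).
Hypotheses (a0 : 0 <= a) (ab : a < b) (bt : b <= t).

Let subab (f : R -> R) : mu.-integrable `]0, t[ (EFin \o f) ->
  mu.-integrable `]a, b[ (EFin \o f).
Proof. by move=> H; apply: integrableS H => //; apply: subset_itv; rewrite bnd_simp. Qed.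

Let speed_int j : mu.-integrable `]a, b[ (EFin \o (fun r => c.2 r 0 j)).
Proof. by apply: subab; case: W11c => _ /(_ j)[]. Qed.

Let speed_FTC j : \int[mu]_(r in `]a, b[) c.2 r 0 j = (c.1 b - c.1 a) 0 j.
Proof.
case: W11c => cc /(_ j)[_ iw wd].
have := weak_derivative_FTC a0 ab bt (within_continuous_coord (i := j) cc) iw wd.
by rewrite !mxE.
Qed.

Let Rint_cst (k : R) : \int[mu]_(r in `]a, b[) k = k * (b - a).
Proof. by rewrite Rintegral_cst//= lebesgue_measure_itv /= lte_fin ab. Qed.

(** The gradient inequality is taken at the mean velocity [q]. With coefficients frozen at the start
    of the step, its linear part integrates to 0, since the velocity integrates to [(b - a) *: q].
    Unfreezing the coefficients is paid for by the padding. *)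
Lemma slow_step (q : V) (K om1 om : R) : 0 <= om1 ->
  c.1 b - c.1 a = (b - a) *: q -> `|q| <= K ->
  (forall r, a < r < b -> `|L (c.1 r) q - L (c.1 a) q| <= om1) ->
  (forall r j, a < r < b -> `|gradv L (c.1 r) q j - gradv L (c.1 a) q j| <= om1) ->
  om1 * (1 + m.+1%:R * K) <= om ->
  (b - a) * L (c.1 a) q <= \int[mu]_(r in `]a, b[) padded_lagrangian om c r.
Proof.
move=> om10 dE qK Lom gom omE.
have K0 : 0 <= K by exact: le_trans qK.
pose G r := L (c.1 a) q + \sum_j gradv L (c.1 a) q j * (c.2 r 0 j - q 0 j).
have Gj j : mu.-integrable `]a, b[ (EFin \o (fun r => gradv L (c.1 a) q j * (c.2 r 0 j - q 0 j))).
  by apply: Z_int; apply: integrable_EFinB => //; exact: (@cst_int _ _ (q 0 j)).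
have Gs : mu.-integrable `]a, b[
    (EFin \o (fun r => \sum_j gradv L (c.1 a) q j * (c.2 r 0 j - q 0 j))).
  have -> : EFin \o (fun r => \sum_j gradv L (c.1 a) q j * (c.2 r 0 j - q 0 j)) =
    (fun r => \sum_(j <- index_enum 'I_m.+1) ((gradv L (c.1 a) q j * (c.2 r 0 j - q 0 j))%:E))%E.
    by apply/funext => r; rewrite /= sumEFin.
  by apply: (integrable_sum (mu := mu)) => // j _; exact: Gj.
have GE : \int[mu]_(r in `]a, b[) G r = (b - a) * L (c.1 a) q.
  rewrite RintegralD//; last exact: (@cst_int _ _ (L (c.1 a) q)).
  rewrite Rint_cst mulrC.
  suff -> : \int[mu]_(r in `]a, b[) (\sum_j gradv L (c.1 a) q j * (c.2 r 0 j - q 0 j)) = 0.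
    by rewrite addr0.
  rewrite /Rintegral; under eq_integral do rewrite -sumEFin.
  rewrite integral_sum; [|by []|by move=> j; exact: Gj].
  rewrite -sum_fine; last first.
    by move=> j _; apply: integrable_fin_num => //; exact: Gj.
  apply: big1 => j _.
  rewrite -[fine _]/(\int[mu]_(r in `]a, b[) _) RintegralZl//; last first.
    by apply: integrable_EFinB => //; exact: (@cst_int _ _ (q 0 j)).
  rewrite RintegralB//; last exact: (@cst_int _ _ (q 0 j)).
  by rewrite speed_FTC Rint_cst dE mxE [(b - a) * _]mulrC subrr mulr0.
rewrite -GE; apply: le_Rintegral => //.
- by apply: integrable_EFinD => //; exact: (@cst_int _ _ (L (c.1 a) q)).
- by apply: subab; exact: padded_lagrangian_integrable.
move=> r; rewrite /= in_itv /= => rab.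
apply: (@le_trans _ _ (L (c.1 r) q + om1 +
   \sum_j (gradv L (c.1 r) q j * (c.2 r - q) 0 j + om1 * (`|c.2 r 0 j| + K)))).
  rewrite /G; apply: lerD.
    by have := Lom r rab; rewrite ler_norml => /andP[]; lra.
  apply: ler_sum => j _; rewrite -lerBlDl !mxE -mulrBl.
  apply: (le_trans (ler_norm _)); rewrite normrM ler_pM//.
    by rewrite distrC gom.
  apply: (le_trans (ler_normB _ _)); rewrite lerD2l.
  by apply: le_trans qK; exact: row_norm_coord.
have := lagrangian_gradient_ineq L_C2 L_pos (c.1 r) (c.2 r) q.
rewrite big_split /= -mulr_sumr big_split /= sumr_const card_ord -[K *+ _]mulr_natl.
rewrite /padded_lagrangian; set S := \sum_j `|c.2 r 0 j|; set T := \sum_j _ => H.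
have S0 : 0 <= S by exact: sumr_ge0.
have n0 : 0 <= m.+1%:R * K by rewrite mulr_ge0.
(* The freezing error is at most [om1] times 1 + S + (m+1)K, which is below the product on the
   left-hand side. *)
have : om1 * (1 + m.+1%:R * K) * (1 + S) <= om * (1 + S) by rewrite ler_wpM2r// addr_ge0.
have : 0 <= om1 * (m.+1%:R * K * S) by rewrite !mulr_ge0.
lra.
Qed.

(** Let D be the displacement. The chord at unit speed lasts |D| and costs at most B|D|. The curve
    costs at least (B + 1)|D| - CM(b - a), and the last term is at most K(b - a), hence at most
    |D|. *)
Lemma fast_step (M CM B K om : R) : 0 <= om -> 0 <= M ->
  (forall x v, M * `|v| - CM <= L x v) ->
  (forall x v, `|v| <= 1 -> L x v <= B) ->
  B + 1 <= M -> CM <= K ->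
  K * (b - a) <= `|c.1 b - c.1 a| -> 0 < `|c.1 b - c.1 a| ->
  `|c.1 b - c.1 a| * L (c.1 a) (`|c.1 b - c.1 a|^-1 *: (c.1 b - c.1 a)) <=
  \int[mu]_(r in `]a, b[) padded_lagrangian om c r.
Proof.
move=> om0 M0 LM LB BM CMK; set D := c.1 b - c.1 a => KD D0.
(* The norm is the sup norm, so a single coordinate of the velocity accounts for the whole
   displacement. *)
have [j Dj] := row_norm_attained D.
have nj := integrable_norm (speed_int j).
have iMj : mu.-integrable `]a, b[ (EFin \o (fun r => M * `|c.2 r 0 j|)) by exact: Z_int.
apply: (@le_trans _ _ (\int[mu]_(r in `]a, b[) (M * `|c.2 r 0 j| - CM))).
  rewrite RintegralB//; last exact: (@cst_int _ _ CM).
  rewrite RintegralZl// Rint_cst.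
  have H : `|D| <= \int[mu]_(r in `]a, b[) `|c.2 r 0 j|.
    by rewrite Dj -speed_FTC; apply: le_normr_Rintegral.
  have H1 : M * `|D| <= M * \int[mu]_(r in `]a, b[) `|c.2 r 0 j| by rewrite ler_wpM2l.
  have H2 : CM * (b - a) <= K * (b - a) by rewrite ler_wpM2r// subr_ge0 ltW.
  have H3 : L (c.1 a) (`|D|^-1 *: D) <= B.
    by apply: LB; rewrite normrZ normfV normr_id mulVf// gt_eqF.
  have H4 : `|D| * L (c.1 a) (`|D|^-1 *: D) <= `|D| * B by rewrite ler_wpM2l// ltW.
  have H5 : `|D| * (B + 1) <= `|D| * M by rewrite ler_wpM2l// ltW.
  lra.
apply: le_Rintegral => //.
- by apply: integrable_EFinB => //; exact: (@cst_int _ _ CM).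
- by apply: subab; exact: padded_lagrangian_integrable.
move=> r _; rewrite /padded_lagrangian.
have := LM (c.1 r) (c.2 r).
have : M * `|c.2 r 0 j| <= M * `|c.2 r| by rewrite ler_wpM2l// row_norm_coord.
have : 0 <= om * (1 + \sum_j `|c.2 r 0 j|) by rewrite mulr_ge0// addr_ge0// sumr_ge0.
lra.
Qed.

End Steps.

(** * The value function *)

Section Geometry.
Variables (R : realType) (m : nat).
Let V := 'rV[R]_m.+1.
Variable Omega : set V.

Lemma exit_point (x w : V) : open Omega -> Omega x -> ~ Omega (x + w) ->
  exists l : R, [/\ 0 < l <= 1, boundary Omega (x + l *: w) &
    forall s, 0 <= s <= l -> closure Omega (x + s *: w)].
Proof.
move=> oO Ox Oy.
have cz (B : set V) l : nbhs (x + l *: w) B ->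
    exists2 e : R, 0 < e & forall s, `|l - s| < e -> B (x + s *: w).
  have cl : {for l, continuous (fun s : R => x + s *: w)}.
    by apply: cvgD; [exact: cvg_cst|apply: cvgZr_tmp].
  move=> /cl /nbhs_ballP[e /= e0 H]; exists e => // s ls; exact: H.
pose C := [set s : R | 0 <= s <= 1 /\ ~ Omega (x + s *: w)].
have C1 : C 1 by split; [rewrite ler01 lexx|rewrite scale1r].
have Clb : lbound C 0 by move=> s [/andP[]].
have hC : has_inf C by split; [exists 1|exists 0].
(* First exit parameter: the complement of [Omega] is closed, so the infimum is attained, and all
   earlier points lie in [Omega]. *)
pose l := inf C.
have l0 : 0 <= l by apply: lb_le_inf => //; exists 1.
have l1 : l <= 1 by apply: ge_inf => //; exists 0.
have nO : ~ Omega (x + l *: w).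
  move=> Ol; have [|e e0 He] := cz Omega l; first exact: open_nbhs_nbhs.
  have [s Cs se] := inf_adherent e0 hC.
  have ls : l <= s by apply: ge_inf => //; exists 0.
  case: Cs => _; apply; apply: He; rewrite ler0_norm; rewrite -/l in se; lra.
have lgt0 : 0 < l.
  rewrite lt_neqAle l0 andbT; apply/eqP => l0'; apply: nO.
  by rewrite -l0' scale0r addr0.
have bel s : 0 <= s -> s < l -> Omega (x + s *: w).
  move=> s0 sl; apply: contrapT => ns.
  suff : l <= s by rewrite leNgt sl.
  apply: ge_inf; first by exists 0.
  by split => //; rewrite s0 (le_trans (ltW sl)).
have cll : closure Omega (x + l *: w).
  move=> B /cz[e e0 He].
  have [s [s0 sl ls]] : exists s : R, [/\ 0 <= s, s < l & `|l - s| < e].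
    have [h|h] := leP (l - e / 2) 0; [exists 0|exists (l - e / 2)]; split => //.
    - by rewrite gtr0_norm; lra.
    - exact: ltW.
    - lra.
    - by rewrite gtr0_norm; lra.
  by exists (x + s *: w); split; [exact: bel|exact: He].
exists l; split.
- by rewrite lgt0.
- by split => // /interior_subset.
- move=> s /andP[s0]; rewrite le_eqVlt => /orP[/eqP ->//|sl].
  by apply: subset_closure; exact: bel.
Qed.

Lemma dist_boundary_le (x y : V) : boundary Omega y ->
  dist_boundary Omega x <= enorm (x - y).
Proof.
move=> by_; apply: ge_inf; last by exists y.
by exists 0 => _ [z _ <-]; exact: enorm_ge0.
Qed.

(** Otherwise the segment from [x] to [x + w] would meet the boundary at Euclidean distance less
    than [rho] from [x]. *)
Lemma inner_ball (rho : R) (x w : V) : open Omega ->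
  inner_region Omega rho x -> enorm w < rho -> Omega (x + w).
Proof.
move=> oO [Ox dx] wr; apply: contrapT => nO.
have [l [/andP[l0 l1] bl _]] := exit_point oO Ox nO.
have := dist_boundary_le x bl; rewrite opprD addNKr enormN enormZ gtr0_norm//.
move=> /(le_trans dx); apply/negP; rewrite -ltNge.
by apply: le_lt_trans wr; rewrite ler_piMl// enorm_ge0.
Qed.

Lemma inner_boundary_dist (rho : R) (x y : V) : inner_region Omega rho x ->
  boundary Omega y -> rho <= m.+1%:R * `|x - y|.
Proof.
move=> [_ dx] by_; apply: le_trans dx _; apply: le_trans (dist_boundary_le x by_) _.
exact: enorm_le_row_norm.
Qed.

Lemma closure_bounded : bounded_set Omega ->
  exists2 r : R, 0 <= r & forall x, closure Omega x -> `|x| <= r.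
Proof.
move=> [M [_ HM]]; exists (`|M| + 1); first by rewrite addr_ge0.
have HO : Omega `<=` [set v : V | `|v| <= `|M| + 1].
  by move=> v Ov; apply: (HM (`|M| + 1)) => //; rewrite (le_lt_trans (ler_norm _))// ltrDl.
have cb := @closed_row_ball R m (`|M| + 1).
by move=> x /(closure_subset HO); rewrite -(closure_id _).1.
Qed.

Lemma bounded_exit (x : V) : open Omega -> bounded_set Omega -> Omega x ->
  exists w : V, boundary Omega (x + w) /\
    forall s : R, 0 <= s <= 1 -> closure Omega (x + s *: w).
Proof.
move=> oO /closure_bounded[r r0 Hr] Ox.
(* Aims at the point all of whose coordinates are [r + 1], outside the closure since points there
   have sup norm at most [r]. *)
pose w0 : V := const_mx (r + 1) - x.
have nO : ~ Omega (x + w0).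
  move=> /subset_closure /Hr; rewrite addrC subrK => H.
  have := le_trans (row_norm_coord (const_mx (r + 1)) 0) H.
  rewrite mxE ger0_norm; lra.
have [l [/andP[l0 l1] bl Hl]] := exit_point oO Ox nO.
exists (l *: w0); split => // s /andP[s0 s1]; rewrite scalerA; apply: Hl.
apply/andP; split; first by apply: mulr_ge0 => //; exact: ltW.
by rewrite ler_piMl// ltW.
Qed.

End Geometry.

(** * Bounds on the value function from prolonged curves *)

Section Value.
Variables (R : realType) (m : nat).
Let V := 'rV[R]_m.+1.
Variables (L : V -> V -> R) (g : V -> R) (Omega : set V).
Hypothesis L_cont : continuous (fun p : V * V => L p.1 p.2).
Variable c0 : R.
Hypothesis c0_ge0 : 0 <= c0.
Hypothesis L_lb : forall x v, - c0 <= L x v.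
Notation u := (value_function Omega L g).

Lemma potential_le y p t c : 0 < t -> Gamma Omega 0 t y p c ->
  (potential Omega L y p <= action L t c)%E.
Proof.
move=> t0 Gc; apply: (@le_trans _ _ (min_action Omega L t y p)).
  by apply: ereal_inf_lbound; exists t.
by apply: ereal_inf_lbound; exists c.
Qed.

Lemma value_le y p t c : boundary Omega y -> 0 < t -> Gamma Omega 0 t y p c ->
  (u p <= (g y)%:E + action L t c)%E.
Proof.
move=> by_ t0 Gc; apply: (@le_trans _ _ ((g y)%:E + potential Omega L y p)%E).
  by apply: ereal_inf_lbound; exists y.
by apply: leeD => //; exact: potential_le.
Qed.

Lemma value_lt p (e : \bar R) : (u p < e)%E ->
  exists y t c, [/\ boundary Omega y, 0 < t, Gamma Omega 0 t y p c &
    ((g y)%:E + action L t c < e)%E].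
Proof.
move=> /ereal_inf_lt[_ [y by_ <-]]; rewrite -lteBrDl//.
move=> /ereal_inf_lt[_ [t /= t0 <-]] /ereal_inf_lt[_ [c Gc <-]].
by rewrite EFinN lteBrDl// => H; exists y, t, c.
Qed.

(** Dynamic programming inequality: an almost optimal curve to [p] is prolonged by the segment.
    Later, every upper bound at a shifted vertex comes from it. *)
Lemma value_step p v tau M : 0 < tau ->
  (forall s, 0 <= s <= tau -> closure Omega (p + s *: v)) ->
  (forall s, 0 <= s <= tau -> L (p + s *: v) v <= M) ->
  u p \is a fin_num ->
  (u (p + tau *: v)%R <= u p + (tau * M)%:E)%E.
Proof.
move=> tau0 seg LM fp; apply/lee_addgt0Pr => e e0.
have [|y [t [c [by_ t0 Gc H]]]] := @value_lt p (u p + e%:E)%E.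
  by rewrite lteDl.
have := value_le by_ (addr_gt0 t0 tau0) (extend_curve_Gamma t0 tau0 Gc seg).
move=> /le_trans; apply.
apply: (@le_trans _ _ ((g y)%:E + (action L t c + (tau * M)%:E))%E).
  by apply: leeD => //; exact: (extend_curve_action L_cont t0 tau0 Gc LM).
by rewrite addeA [leRHS]addeAC; apply: leeD => //; exact: ltW.
Qed.

(** Any curve from a boundary point [y] to [p], prolonged by the segment, joins [y] to a fixed
    boundary point. Compatibility of [g] then bounds its cost from below independently of [y]. *)
Lemma value_lower (g_compatible : forall x y : V,
      boundary Omega x -> boundary Omega y ->
      ((g x - g y)%R%:E <= potential Omega L y x)%E) p v tau M : 0 < tau ->
  boundary Omega (p + tau *: v) ->
  (forall s, 0 <= s <= tau -> closure Omega (p + s *: v)) ->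
  (forall s, 0 <= s <= tau -> L (p + s *: v) v <= M) ->
  ((g (p + tau *: v) - tau * M)%:E <= u p)%E.
Proof.
move=> tau0 bp seg LM; apply: le_ereal_inf_tmp => _ [y by_ <-].
rewrite -leeBlDl//; apply: le_ereal_inf_tmp => _ [t t0 <-].
apply: le_ereal_inf_tmp => _ [c Gc <-].
rewrite leeBlDl//.
have := g_compatible _ _ bp by_.
move=> /le_trans /(_ (potential_le (addr_gt0 t0 tau0) (extend_curve_Gamma t0 tau0 Gc seg))).
move=> /le_trans /(_ (extend_curve_action L_cont t0 tau0 Gc LM)).
have Wc : W11 0 t c.1 c.2 by case: Gc.
have := action_gtNy L_cont c0_ge0 L_lb Wc.
case: (action L t c) => [A| |]//.
  by rewrite -!EFinD !lee_fin => _; lra.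
by move=> _ _; rewrite addey// leey.
Qed.

(** The curve rests at [y] for unit time before running along the segment, because prolongation
    starts from a curve of positive duration; hence the term [L y 0]. *)
Lemma value_upper y v tau M : 0 < tau -> boundary Omega y ->
  (forall s, 0 <= s <= tau -> closure Omega (y + s *: v)) ->
  (forall s, 0 <= s <= tau -> L (y + s *: v) v <= M) ->
  (u (y + tau *: v)%R <= (g y + L y 0%R + tau * M)%R%:E)%E.
Proof.
move=> tau0 by_ seg LM.
have Gc : Gamma Omega 0 1 y y (cst y, cst 0).
  by apply: constant_curve_Gamma => //; case: by_.
have := value_le by_ (addr_gt0 ltr01 tau0) (extend_curve_Gamma ltr01 tau0 Gc seg).
move=> /le_trans; apply.
rewrite -addrA EFinD; apply: leeD => //.
have := extend_curve_action L_cont ltr01 tau0 Gc LM.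
by rewrite constant_curve_action// mul1r.
Qed.

Lemma lagrangian_segment_bound (r : R) (v : V) :
  exists M : R, forall p, `|p| <= r -> L p v <= M.
Proof.
have [M M0 H] := continuous_compact_bound (@compact_pair_ball R m (Num.max r `|v|)) L_cont.
exists M => p pr; apply: le_trans (ler_norm _) _; apply: (H (p, v)).
by rewrite /= prod_normE /= ge_max !le_max pr lexx orbT.
Qed.

(** One segment to the boundary serves both bounds: run outwards it gives the lower one, run
    backwards the upper one. For a boundary point the segment is constant. *)
Lemma value_fin_num (g_compatible : forall x y : V,
      boundary Omega x -> boundary Omega y ->
      ((g x - g y)%R%:E <= potential Omega L y x)%E) p :
  bounded_set Omega -> open Omega -> closure Omega p -> u p \is a fin_num.
Proof.
move=> bO oO cp.
have [r r0 Hr] := closure_bounded bO.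
suff [w [bw segw]] : exists w : V, boundary Omega (p + w) /\
    forall s : R, 0 <= s <= 1 -> closure Omega (p + s *: w).
  have [M1 HM1] := lagrangian_segment_bound r w.
  have [M2 HM2] := lagrangian_segment_bound r (- w).
  have seg2 s : 0 <= s <= 1 -> closure Omega (p + w + s *: - w).
    move=> /andP[s0 s1]; have -> : p + w + s *: - w = p + (1 - s) *: w.
      by rewrite -addrA scalerN scalerBl scale1r.
    by apply: segw; apply/andP; split; lra.
  have lo := @value_lower g_compatible p w 1 M1 ltr01.
  have up := @value_upper (p + w) (- w) 1 M2 ltr01 bw seg2 _.
  rewrite !scale1r addrK in lo up.
  rewrite fin_numElt; apply/andP; split.
    apply: lt_le_trans (lo bw segw _); first exact: ltNyr.
    by move=> s s01; apply: HM1; apply: Hr; exact: segw.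
  apply: le_lt_trans (up _) _; last exact: ltry.
  by move=> s s01; apply: HM2; apply: Hr; exact: seg2.
have [Op|nOp] := pselect (Omega p); first exact: bounded_exit.
exists 0; rewrite addr0; split.
  by split => // /interior_subset.
by move=> s _; rewrite scaler0 addr0.
Qed.

End Value.

(** * Polygonal chains *)

Section Chain.
Variables (R : realType) (m : nat).
Let V := 'rV[R]_m.+1.
Notation mu := (@lebesgue_measure R).
Variable L : V -> V -> R.
Hypothesis L_C2 : is_C2 (fun p : V * V => L p.1 p.2).
Hypothesis L_pos : forall x v, posdefmx (hessian_v L x v).

Lemma lagrangian_modulus (r e : R) : 0 < e ->
  exists2 d : R, 0 < d & forall x y v, `|x| <= r -> `|y| <= r -> `|v| <= r ->
    `|x - y| < d -> `|L x v - L y v| < e /\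
     forall j, `|gradv L x v j - gradv L y v j| < e.
Proof.
move=> e0.
have cK := @compact_pair_ball R m r.
have [d0 d00 H0] := continuous_compact_modulus cK
  (continuous_subspaceT (continuous_lagrangian L_C2)) e0.
have /choice[d Hd] : forall j, exists d : R, 0 < d /\ forall p q : V * V,
    `|p| <= r -> `|q| <= r -> `|p - q| < d ->
    `|gradv L p.1 p.2 j - gradv L q.1 q.2 j| < e.
  move=> j; have [d dd H] := continuous_compact_modulus cK
    (continuous_subspaceT (continuous_gradv L_C2 (j := j))) e0.
  by exists d.
exists (\big[Num.min/d0]_j d j).
  by apply: lt_bigmin => // j _; case: (Hd j).
move=> x y v xr yr vr xy.
have nx : `|((x, v) : V * V)| <= r by rewrite prod_normE ge_max xr.
have ny : `|((y, v) : V * V)| <= r by rewrite prod_normE ge_max yr.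
have dE : `|(x, v) - (y, v) : V * V| = `|x - y|.
  by rewrite prod_normE /= subrr normr0 max_l.
split.
  apply: (H0 (x, v) (y, v)) => //; rewrite dE; apply: lt_le_trans xy _.
  exact: bigmin_le_id.
move=> j; apply: ((Hd j).2 (x, v) (y, v)) => //; rewrite dE; apply: lt_le_trans xy _.
exact: bigmin_le.
Qed.

Variables (t : R) (c : (R -> V) * (R -> V)).
Hypothesis t_gt0 : 0 < t.
Hypothesis W11c : W11 0 t c.1 c.2.
Hypothesis Lc_int :
  mu.-integrable `]0, t[ (EFin \o (fun r => L (c.1 r) (c.2 r))).
Variable Rb : R.
Hypothesis c_bounded : forall r, r \in `[0, t] -> `|c.1 r| <= Rb.
Variables M CM B K : R.
Hypothesis M_ge0 : 0 <= M.
Hypothesis K_ge1 : 1 <= K.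
Hypothesis L_growth : forall x v, M * `|v| - CM <= L x v.
Hypothesis L_unit : forall x v, `|v| <= 1 -> L x v <= B.
Hypothesis BM : B + 1 <= M.
Hypothesis CMK : CM <= K.

(** The vertices sample the curve on a uniform grid, but [tau i] is the time in which the chord is
    run, not the mesh: a fast step is slowed down, so the total time may exceed [t]. *)
Lemma curve_chain (om dl : R) : 0 < om -> 0 < dl ->
  exists N (tau : nat -> R) (q : nat -> V), (0 < N)%N /\
    forall i, (i < N)%N ->
    [/\ 0 < tau i, tau i <= dl, `|q i| <= K,
        c.1 (i.+1%:R * (t / N%:R)) = c.1 (i%:R * (t / N%:R)) + tau i *: q i &
        tau i * L (c.1 (i%:R * (t / N%:R))) (q i) <=
        \int[mu]_(r in `]i%:R * (t / N%:R), i.+1%:R * (t / N%:R)[)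
           padded_lagrangian L om c r].
Proof.
move=> om0 dl0.
have K0 : 0 < K by exact: lt_le_trans K_ge1.
have Rb0 : 0 <= Rb.
  have z : 0 \in `[0, t] by rewrite in_itv /= lexx ltW.
  exact: le_trans (normr_ge0 _) (c_bounded z).
have w0 : 0 < 1 + m.+1%:R * K by rewrite ltr_wpDr// mulr_ge0// ltW.
have om10 : 0 < om / (1 + m.+1%:R * K) by rewrite divr_gt0.
have [dm dm0 Hdm] := @lagrangian_modulus (Rb + K) _ om10.
have [|dc dc0 Hdc] := @continuous_compact_modulus R R V c.1 `[0, t] (Num.min dm dl)
   (@segment_compact R 0 t) W11c.1.
  by rewrite lt_min dm0.
have mn0 : 0 < Num.min dc dl by rewrite lt_min dc0.
(* A mesh below [dl] bounds [tau] on slow steps. A mesh below [dc] keeps displacements under [dl],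
   which bounds [tau] on fast steps, and under [dm], which controls the freezing error. *)
pose N := (Num.bound (t / Num.min dc dl)).+1.
have N0 : 0 < N%:R :> R by rewrite ltr0n.
have hN : t / N%:R < Num.min dc dl.
  rewrite ltr_pdivrMr// mulrC -ltr_pdivrMr//.
  apply: (@lt_trans _ _ (Num.bound (t / Num.min dc dl))%:R).
    by apply: archi_boundP; rewrite divr_ge0 ?ltW.
  by rewrite ltr_nat.
pose h := t / N%:R.
have h0 : 0 < h by rewrite divr_gt0.
have hdc : h < dc by apply: lt_le_trans hN _; rewrite ge_min lexx.
have hdl : h < dl by apply: lt_le_trans hN _; rewrite ge_min lexx orbT.
pose D i : V := c.1 (i.+1%:R * h) - c.1 (i%:R * h).
(* Mean speed at most [K]: keep the mesh [h]. Otherwise the duration is the length of the chord, so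
   the speed is 1. *)
pose tau i := if `|D i| <= K * h then h else `|D i|.
exists N, tau, (fun i => (tau i)^-1 *: D i); split => // i iN.
rewrite -/h.
have si : i.+1%:R * h - i%:R * h = h by rewrite -mulrBl -natrB// subSnn mul1r.
have si0 : 0 <= i%:R * h by rewrite mulr_ge0// ltW.
have sit : i.+1%:R * h <= t.
  by rewrite /h mulrA ler_pdivrMr// [t * _]mulrC ler_wpM2r ?ler_nat// ltW.
have sab : i%:R * h < i.+1%:R * h by rewrite -subr_gt0 si.
have in_i r : i%:R * h <= r -> r <= i.+1%:R * h -> r \in `[0, t].
  by move=> h1 h2; rewrite in_itv /= (le_trans si0 h1) (le_trans h2 sit).
have near_i r : i%:R * h <= r -> r <= i.+1%:R * h ->
    `|c.1 r - c.1 (i%:R * h)| < Num.min dm dl.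
  move=> h1 h2; apply: Hdc.
  - exact: in_i.
  - by apply: in_i => //; exact: ltW.
  - by apply: le_lt_trans hdc; rewrite ger0_norm; lra.
have Ddl : `|D i| < dl.
  by have := near_i _ (ltW sab) (lexx _); rewrite lt_min => /andP[].
have tau0 : 0 < tau i.
  rewrite /tau; case: (leP `|D i| (K * h)) => H; first exact: h0.
  by apply: le_lt_trans H; rewrite mulr_ge0// ltW.
have taudl : tau i <= dl by rewrite /tau; case: ifP => _; rewrite ltW.
have qK : `|(tau i)^-1 *: D i| <= K.
  rewrite normrZ gtr0_norm ?invr_gt0// ler_pdivrMl// mulrC /tau.
  by case: (leP `|D i| (K * h)) => // H; rewrite ler_peMl.
split => //.
  by rewrite scalerA divff ?gt_eqF// scale1r /D addrC subrK.
move: qK; rewrite /tau; case: (leP `|D i| (K * h)) => H qK.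
  have := @slow_step _ _ _ L_C2 L_pos _ _ W11c Lc_int _ _ si0 sab sit (h^-1 *: D i) K
    (om / (1 + m.+1%:R * K)) om.
  rewrite si; apply => //.
  - exact: ltW.
  - by rewrite scalerA divff ?gt_eqF// scale1r.
  - move=> r /andP[r1 r2].
    have := near_i r (ltW r1) (ltW r2); rewrite lt_min => /andP[rd _].
    apply/ltW; apply: (Hdm _ _ _ _ _ _ rd).1.
    + by apply: le_trans (c_bounded (in_i _ (ltW r1) (ltW r2))) _; rewrite lerDl ltW.
    + by apply: le_trans (c_bounded (in_i _ (lexx _) (ltW sab))) _; rewrite lerDl ltW.
    + by apply: le_trans qK _; rewrite lerDr.
  - move=> r j /andP[r1 r2].
    have := near_i r (ltW r1) (ltW r2); rewrite lt_min => /andP[rd _].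
    apply/ltW; apply: (Hdm _ _ _ _ _ _ rd).2.
    + by apply: le_trans (c_bounded (in_i _ (ltW r1) (ltW r2))) _; rewrite lerDl ltW.
    + by apply: le_trans (c_bounded (in_i _ (lexx _) (ltW sab))) _; rewrite lerDl ltW.
    + by apply: le_trans qK _; rewrite lerDr.
  - by rewrite divfK// gt_eqF.
apply: (fast_step W11c Lc_int si0 sab sit (M := M) (CM := CM) (B := B) (K := K)) => //.
- exact: ltW.
- by rewrite si ltW.
- by apply: lt_trans H; rewrite mulr_gt0.
Qed.

End Chain.

(** * Perturbing a polygon linearly in time *)

Section Perturbation.
Variables (R : realType) (V : normedModType R).
Variables (U : V -> R) (L : V -> V -> R).
Variables (p q : nat -> V) (tau cost : nat -> R) (i0 N : nat).
Hypothesis i0N : (i0 <= N)%N.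
Hypothesis tau_gt0 : forall i, (i0 <= i < N)%N -> 0 < tau i.
Hypothesis pS : forall i, (i0 <= i < N)%N -> p i.+1 = p i + tau i *: q i.

Let S k := \sum_(i0 <= i < k) tau i.

Lemma chain_dist (K : R) : (forall i, (i0 <= i < N)%N -> `|q i| <= K) ->
  `|p N - p i0| <= K * S N.
Proof.
move=> qK; suff H d : (i0 + d <= N)%N -> `|p (i0 + d)%N - p i0| <= K * S (i0 + d).
  by have := H (N - i0)%N; rewrite subnKC//; apply.
elim: d => [|d IH]; rewrite ?addn0 ?addnS => kN.
  by rewrite subrr normr0 /S big_geq// mulr0.
have ikN : (i0 <= i0 + d < N)%N by rewrite leq_addr.
rewrite /S big_nat_recr ?leq_addr//= mulrDr pS// addrAC.
apply: (le_trans (ler_normD _ _)); apply: lerD; first by apply: IH => //; exact: ltnW.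
by rewrite normrZ gtr0_norm ?tau_gt0// mulrC ler_wpM2r ?qK// ltW// tau_gt0.
Qed.

Variables (z : V) (E om : R).
Hypothesis S_gt0 : 0 < S N.
Hypothesis cost_ge : forall i, (i0 <= i < N)%N -> tau i * L (p i) (q i) <= cost i.
Hypothesis U_step : forall i w, (i0 <= i < N)%N -> w = z \/ w = - z ->
  U ((p i + (S i / S N) *: w) + tau i *: (q i + (S N)^-1 *: w)) <=
  U (p i + (S i / S N) *: w) +
    tau i * (L (p i + (S i / S N) *: w) (q i + (S N)^-1 *: w) + om).
Hypothesis L_second : forall i, (i0 <= i < N)%N ->
  L (p i + (S i / S N) *: z) (q i + (S N)^-1 *: z) +
  L (p i - (S i / S N) *: z) (q i - (S N)^-1 *: z) - 2 * L (p i) (q i) <= E.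

(* The perturbation grows linearly in time from 0 at [p i0] to [z] at [p N]. *)
Lemma chain_perturbation :
  U (p N + z) + U (p N - z) <=
  2 * U (p i0) + 2 * \sum_(i0 <= i < N) cost i + S N * (E + 2 * om).
Proof.
suff H d : (i0 + d <= N)%N ->
    U (p (i0 + d)%N + (S (i0 + d) / S N) *: z) +
    U (p (i0 + d)%N + (S (i0 + d) / S N) *: - z) <=
    2 * U (p i0) + 2 * \sum_(i0 <= i < i0 + d) cost i + S (i0 + d) * (E + 2 * om).
  by have := H (N - i0)%N; rewrite subnKC// divff ?gt_eqF// !scale1r; apply.
elim: d => [|d IH]; rewrite ?addn0 ?addnS => kN.
  have S0 : S i0 = 0 by rewrite /S big_geq.
  by rewrite S0 big_geq// !mul0r !scale0r !addr0; lra.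
have {}IH := IH (ltnW kN).
have : (i0 <= i0 + d)%N by exact: leq_addr.
move: (i0 + d)%N kN IH => k kN IH ik.
have ikN : (i0 <= k < N)%N by rewrite ik.
have SS : S k.+1 = S k + tau k by rewrite /S big_nat_recr.
(* During step [k] the shift grows by the fraction [tau k / S N] of [w], so the velocity changes by
   [(S N)^-1 *: w]. *)
have E1 w : p k.+1 + (S k.+1 / S N) *: w =
    (p k + (S k / S N) *: w) + tau k *: (q k + (S N)^-1 *: w).
  by rewrite pS// SS mulrDl scalerDl scalerDr scalerA addrACA.
rewrite !E1.
have H1 := U_step ikN (or_introl erefl).
have H2 := U_step ikN (or_intror erefl).
have H3 := L_second ikN.
have H4 := cost_ge ikN.
have t0 := tau_gt0 ikN.
rewrite [\sum_(i0 <= i < k.+1) _]big_nat_recr//= SS.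
rewrite !scalerN in H2 IH *.
move: (L (p k + _) _) (L (p k - _) _) H1 H2 H3 => A B H1 H2 H3.
have H5 : tau k * (A + B - 2 * L (p k) (q k)) <= tau k * E by rewrite ler_wpM2l// ltW.
lra.
Qed.

End Perturbation.

(** * Semiconcavity *)

Lemma sum_Rintegral_itv (R : realType) (F : R -> R) (h t : R) (i0 k : nat) :
  0 < h -> (i0 <= k)%N -> k%:R * h <= t ->
  (@lebesgue_measure R).-integrable `]0, t[ (EFin \o F) ->
  \sum_(i0 <= i < k) \int[lebesgue_measure]_(r in `]i%:R * h, i.+1%:R * h[) F r =
  \int[lebesgue_measure]_(r in `]i0%:R * h, k%:R * h[) F r.
Proof.
move=> h0 ik kt intF; rewrite -(subnKC ik).
have : (i0 + (k - i0))%:R * h <= t by rewrite subnKC.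
elim: (k - i0)%N => [|d IH]; rewrite ?addn0 ?addnS => dt.
  by rewrite big_geq// set_itvoo0 Rintegral_set0.
have lt1 j : j%:R * h < j.+1%:R * h by rewrite ltr_pM2r// ltr_nat.
rewrite big_nat_recr ?leq_addr//= IH; last exact: le_trans (ltW (lt1 _)) dt.
(* The splitting lemma requires nondegenerate intervals, so the empty first piece is treated
   apart. *)
have [->|d0] := eqVneq d 0%N.
  by rewrite addn0 set_itvoo0 Rintegral_set0 add0r.
rewrite -Rintegral_itv_split//.
  by rewrite ltr_pM2r// ltr_nat -[X in (X < _)%N]addn0 ltn_add2l lt0n.
apply: integrableS intF => //; apply: subset_itv; rewrite bnd_simp//.
by rewrite mulr_ge0// ltW.
Qed.

(** Linear bookkeeping with integrals as letters: [A] is the full action, [W] the full padding, [F1]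
    and [F2] the padded actions before and after the cut, [L1] the plain action before it. *)
Lemma action_bound_arith (R : realType) (up ux g A W F1 F2 L1 e : R) :
  up <= g + L1 -> L1 <= F1 -> A + W = F1 + F2 -> g + A < ux + e / 2 ->
  W <= e / 2 -> up + F2 <= ux + e.
Proof. by move=> *; lra. Qed.

Section Semiconcavity.
Variables (R : realType) (m : nat).
Let V := 'rV[R]_m.+1.
Notation mu := (@lebesgue_measure R).
Variables (L : V -> V -> R) (g : V -> R) (Omega : set V).
Hypothesis L_tonelli : tonelli L.
Hypothesis Omega_open : open Omega.
Hypothesis Omega_bounded : bounded_set Omega.
Notation u := (value_function Omega L g).
Hypothesis u_fin : forall x, closure Omega x -> u x \is a fin_num.
Let U x := fine (u x).

Let L_C2 : is_C2 (fun p : V * V => L p.1 p.2).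
Proof. by case: L_tonelli. Qed.

Let L_pos x v : posdefmx (hessian_v L x v).
Proof. by case: L_tonelli. Qed.

Let L_cont : continuous (fun p : V * V => L p.1 p.2).
Proof. exact: continuous_lagrangian. Qed.

(** The polygon is cut at the last vertex from which at least [T] remains; as steps last at most
    [dl <= T], at most [2 * T] remains. Before the cut the original curve is kept, as a competitor
    for the value at that vertex. *)
Lemma almost_optimal_chain : exists2 K : R, 1 <= K &
  forall (x : V) (T dl e : R), closure Omega x -> 0 < T -> 0 < dl -> dl <= T -> 0 < e ->
  (forall y, boundary Omega y -> 2 * K * T < `|x - y|) ->
  exists (i0 N : nat) (p q : nat -> V) (tau cost : nat -> R),
  [/\ (i0 <= N)%N,
    forall i, (i0 <= i < N)%N -> [/\ 0 < tau i <= dl, `|q i| <= K,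
      p i.+1 = p i + tau i *: q i, tau i * L (p i) (q i) <= cost i &
      closure Omega (p i)],
    p N = x, T <= \sum_(i0 <= i < N) tau i <= 2 * T &
    U (p i0) + \sum_(i0 <= i < N) cost i <= U x + e].
Proof.
have [c0 c00 Lc0] := tonelli_lower_bound L_tonelli.
have [B B0 LB] := tonelli_unit_bound L_tonelli.
have B1 : 0 <= B + 1 by rewrite addr_ge0.
have [CM CM0 LCM] := tonelli_linear_growth L_tonelli B1.
have [Rb Rb0 HRb] := closure_bounded Omega_bounded.
have K1 : 1 <= CM + 1 by rewrite lerDr.
exists (CM + 1) => // x T dl e Ox T0 dl0 dlT e0 far.
set K := CM + 1 in K1 far *.
have CMK : CM <= K by rewrite lerDl.
have K0 : 0 < K by exact: lt_le_trans K1.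
have ux := u_fin Ox.
have [|y [t [c [by_ t0 Gc uc]]]] := @value_lt _ _ L g Omega x (u x + (e / 2)%:E)%E.
  by rewrite lteDl// lte_fin divr_gt0.
have [Wc cO cy cx] := Gc.
have act_lt : (action L t c < +oo)%E.
  rewrite ltey; apply/eqP => A; move: uc; rewrite A addey//.
  by rewrite -(fineK ux) -EFinD.
have [Lint actE] := finite_action L_cont c00 Lc0 Wc act_lt.
have [A AE] : exists A, A = \int[mu]_(r in `]0, t[) L (c.1 r) (c.2 r) by eexists.
rewrite -AE in actE.
have gA : g y + A < U x + e / 2.
  by move: uc; rewrite actE -(fineK ux) -!EFinD lte_fin.
have Sint := sum_speed_integrable Wc.
have wint : mu.-integrable `]0, t[ (EFin \o (fun r => 1 + \sum_j `|c.2 r 0 j|)).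
  apply: integrable_EFinD => //; apply: (@continuous_itv_integrable _ (cst 1)).
  by apply: continuous_subspaceT; exact: cst_continuous.
pose S1 := \int[mu]_(r in `]0, t[) (1 + \sum_j `|c.2 r 0 j|).
have S10 : 0 <= S1.
  by apply: Rintegral_ge0 => r _; rewrite addr_ge0// sumr_ge0.
(* The total padding [om * S1] is at most [e / 2]; the other half of [e] is spent on near
   optimality. *)
pose om := (e / 2) / (1 + S1).
have om0 : 0 < om by rewrite divr_gt0 ?divr_gt0// ltr_wpDr.
have omS : om * S1 <= e / 2.
  have e20 : 0 <= e / 2 by rewrite divr_ge0// ltW.
  by rewrite /om mulrAC ler_pdivrMr ?ltr_wpDr//; apply: ler_wpM2l => //; lra.
have cb r : r \in `[0, t] -> `|c.1 r| <= Rb by move=> /cO /HRb.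
have [N [tau [q [N0 chain]]]] := curve_chain L_C2 L_pos t0 Wc Lint cb B1 K1 LCM LB
  (lexx _) CMK om0 dl0.
set h := t / N%:R in chain.
have N0' : 0 < N%:R :> R by rewrite ltr0n.
have h0 : 0 < h by rewrite divr_gt0.
have Nh : N%:R * h = t by rewrite /h mulrC divfK// gt_eqF.
pose p i := c.1 (i%:R * h).
pose F := padded_lagrangian L om c.
have Fint := padded_lagrangian_integrable Wc Lint om.
have pN : p N = x by rewrite /p Nh.
have it i : (i <= N)%N -> i%:R * h <= t by move=> iN; rewrite -Nh ler_wpM2r ?ler_nat// ltW.
have pcl i : (i <= N)%N -> closure Omega (p i).
  by move=> iN; apply: cO; rewrite in_itv /= mulr_ge0 ?it// ltW.
pose rem i := \sum_(i <= j < N) tau j.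
have rem_lt i : (i < N)%N -> rem i = tau i + rem i.+1 by move=> iN; rewrite /rem big_ltn.
(* At speed at most [K], covering a distance above [2 * K * T] takes more than [2 * T]. *)
have rem0 : 2 * T < rem 0%N.
  have := @chain_dist _ _ p q tau 0%N N (leq0n _) _ _ K _.
  have p0 : p 0%N = y by rewrite /p mul0r.
  rewrite pN p0 => H.
  have := lt_le_trans (far y by_) (H _ _ _).
  rewrite [2 * K]mulrC -mulrA ltr_pM2l//; apply.
  - by move=> i /andP[_ /chain[]].
  - by move=> i /andP[_ /chain[]].
  - by move=> i /andP[_ /chain[]].
have remN : rem N = 0 by rewrite /rem big_geq.
pose P i := (i <= N)%N && (T <= rem i).
have exP : exists i, P i by exists 0%N; rewrite /P /=; lra.
have [i0 /andP[i0N Ti0] maxi0] := ex_maxnP exP (fun i (H : P i) => (andP H).1).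
have i0lt : (i0 < N)%N.
  rewrite ltn_neqAle i0N andbT; apply/eqP => iE; move: Ti0; rewrite iE remN; lra.
have remS : rem i0.+1 < T.
  rewrite ltNge; apply/negP => H.
  by have := maxi0 i0.+1; rewrite /P i0lt H ltnn => /(_ isT).
have [ti0 tid _ _ _] := chain i0 i0lt.
(* A cut at vertex 0 would leave less than [2 * T] in total. A positive index gives the retained
   initial curve a positive duration. *)
have i00 : (0 < i0)%N.
  rewrite lt0n; apply/eqP => i0E; move: rem0 remS ti0 tid.
  rewrite i0E rem_lt//; lra.
exists i0, N, p, q, tau, (fun i => \int[mu]_(r in `]i%:R * h, i.+1%:R * h[) F r); split => //.
- move=> i /andP[_ iN]; have [a1 a2 a3 a4 a5] := chain i iN; split => //.
    by rewrite a1.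
  by apply: pcl; exact: ltnW.
- by rewrite -/(rem i0) Ti0 /= rem_lt//; lra.
rewrite (@sum_Rintegral_itv _ F h t)//; last by rewrite Nh.
rewrite Nh.
have s0 : 0 < i0%:R * h by rewrite mulr_gt0// ltr0n.
have st : i0%:R * h < t by rewrite -Nh ltr_pM2r// ltr_nat.
have Gs := restrict_curve_Gamma s0 (ltW st) Gc.
have Ws : W11 0 (i0%:R * h) c.1 c.2 by case: Gs.
have Lints : mu.-integrable `]0, (i0%:R * h)[ (EFin \o (fun r => L (c.1 r) (c.2 r))).
  by apply: integrableS Lint => //; apply: subset_itv; rewrite bnd_simp// ltW.
have Fints : mu.-integrable `]0, (i0%:R * h)[ (EFin \o F).
  by apply: integrableS Fint => //; apply: subset_itv; rewrite bnd_simp// ltW.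
have up : U (p i0) <= g y + \int[mu]_(r in `]0, (i0%:R * h)[) L (c.1 r) (c.2 r).
  have := @value_le _ _ L g Omega _ _ _ _ by_ s0 Gs.
  rewrite (actionE L_cont Ws).
  rewrite -[X in (_ <= _ + X)%E]fineK; last by apply: integrable_fin_num Lints.
  by rewrite -(fineK (u_fin (pcl _ i0N))) -EFinD lee_fin.
have FL : \int[mu]_(r in `]0, (i0%:R * h)[) L (c.1 r) (c.2 r) <=
    \int[mu]_(r in `]0, (i0%:R * h)[) F r.
  apply: le_Rintegral => // r _; rewrite lerDl; apply: mulr_ge0; first exact: ltW.
  by rewrite addr_ge0// sumr_ge0.
have FE : \int[mu]_(r in `]0, t[) F r = A + om * S1.
  by rewrite AE RintegralD//; [rewrite RintegralZl|
    have := @integrableZl _ _ _ mu _ _ om _ wint; exact].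
have FS := Rintegral_itv_split s0 st Fint; rewrite FE in FS.
exact: action_bound_arith up FL FS gA omS.
Qed.

End Semiconcavity.

(** Of the [6 * e], two come from the almost optimal chain, counted for both shifts, and four from
    [S * (2 * om)] with [S <= 2 * T] and [T * om = e]. *)
Lemma perturbation_bound_arith (R : realType) (T S E om uxp uxm u0 c ux e : R) :
  0 < T -> T <= S -> S <= 2 * T -> 0 <= E -> T * om = e -> 0 < e ->
  uxp + uxm <= 2 * u0 + 2 * c + S * (E + 2 * om) -> u0 + c <= ux + e ->
  uxp + uxm - 2 * ux <= 2 * T * E + 6 * e.
Proof.
move=> T0 TS ST E0 Te e0 H1 H2.
have om0 : 0 <= om by rewrite -(ler_pM2l T0) mulr0 Te ltW.
have : S * (E + 2 * om) <= 2 * T * (E + 2 * om).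
  by rewrite ler_wpM2r// addr_ge0// mulr_ge0.
lra.
Qed.

(** * From polygons to the semiconcavity estimate *)

Section Semiconcavity.
Variables (R : realType) (m : nat).
Let V := 'rV[R]_m.+1.
Variables (L : V -> V -> R) (g : V -> R) (Omega : set V).
Hypothesis L_tonelli : tonelli L.
Hypothesis Omega_open : open Omega.
Hypothesis Omega_bounded : bounded_set Omega.
Notation u := (value_function Omega L g).
Hypothesis u_fin : forall x, closure Omega x -> u x \is a fin_num.
Let U x := fine (u x).

Let L_C2 : is_C2 (fun p : V * V => L p.1 p.2).
Proof. by case: L_tonelli. Qed.

Let L_cont : continuous (fun p : V * V => L p.1 p.2).
Proof. exact: continuous_lagrangian. Qed.

(** [A] is the displacement along the polygon, measured in the sup norm, and [b] the shift; their
    sum has Euclidean norm at most [rho / 4]. *)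
Lemma inner_tube (rho : R) (x A b : V) : inner_region Omega rho x -> 0 < rho ->
  m.+1%:R * `|A| <= rho / 8 -> enorm b < rho / 8 -> Omega (x + (A + b)).
Proof.
move=> xin rho0 HA Hb; apply: (inner_ball Omega_open xin).
rewrite -(@ltr_pXn2r _ 2) ?nnegrE ?enorm_ge0// ?ltW//.
apply: le_lt_trans (enormD_sqr_le A b) _.
have r80 : 0 <= rho / 8 by rewrite divr_ge0// ltW.
have hA : enorm A ^+ 2 <= (rho / 8) ^+ 2.
  rewrite ler_pXn2r ?nnegrE ?enorm_ge0//.
  exact: le_trans (enorm_le_row_norm A) HA.
have hb : enorm b ^+ 2 <= (rho / 8) ^+ 2.
  by rewrite ler_pXn2r ?nnegrE ?enorm_ge0//; exact: ltW.
have : 0 < rho ^+ 2 by rewrite exprn_gt0.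
move: hA hb; rewrite exprMn; lra.
Qed.

Lemma value_step_real (p v : V) (tau M : R) : 0 < tau ->
  (forall s, 0 <= s <= tau -> closure Omega (p + s *: v)) ->
  (forall s, 0 <= s <= tau -> L (p + s *: v) v <= M) ->
  U (p + tau *: v) <= U p + tau * M.
Proof.
move=> tau0 seg LM.
have cp : closure Omega p.
  by have := seg 0; rewrite scale0r addr0; apply; rewrite lexx ltW.
have cq : closure Omega (p + tau *: v) by apply: seg; rewrite lexx ltW.
have := @value_step R m L g Omega L_cont p v tau M tau0 seg LM (u_fin cp).
by rewrite -(fineK (u_fin cp)) -(fineK (u_fin cq)) -EFinD lee_fin.
Qed.

Lemma semiconcave_inner (rho : R) : 0 < rho -> exists2 D : R, 0 <= D &
  forall x z : V, inner_region Omega rho x -> enorm z < rho / 8 ->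
  U (x + z) + U (x - z) - 2 * U x <= D * enorm z ^+ 2.
Proof.
move=> rho0.
have [K K1 chain] := almost_optimal_chain L_tonelli Omega_bounded u_fin.
have K0 : 0 < K by exact: lt_le_trans K1.
have [Rb Rb0 HRb] := closure_bounded Omega_bounded.
have m0 : 0 < m.+1%:R :> R by rewrite ltr0n.
(* Vertices stay within [2 * K * T] of [x] and a partial step adds at most [K * T]; [4 * K * T]
   leaves room, and the dimension factor converts the sup norm to the Euclidean one. *)
pose T := rho / 8 / (m.+1%:R * (4 * K)).
have mK0 : 0 < m.+1%:R * (4 * K) by rewrite !mulr_gt0.
have T0 : 0 < T by apply: divr_gt0 => //; exact: divr_gt0.
have TE : m.+1%:R * (4 * K * T) = rho / 8.
  by rewrite mulrA [LHS]mulrC /T divfK// gt_eqF.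
(* Bounds the shifted velocities: the shift has norm at most [rho] and is spread over a time at
   least [T]. *)
pose Vb := K + rho / T.
have Vb0 : 0 < Vb by rewrite addr_gt0// divr_gt0.
pose r := Rb + rho + Vb.
have [C2 C20 HC2] := lagrangian_second_difference L_C2 r.
(* The position shift is at most [|z|] and the velocity shift at most [|z| / T], hence the sum of
   two squares. *)
pose E0 := C2 * (1 + T^-1 ^+ 2).
have E00 : 0 <= E0 by rewrite mulr_ge0// addr_ge0// sqr_ge0.
exists (2 * T * E0); first by apply: mulr_ge0 => //; apply: mulr_ge0 => //; exact: ltW.
move=> x z xin zr; apply/ler_addgt0Pr => e e0.
have Ox : Omega x by case: xin.
have zn : `|z| <= enorm z by exact: row_norm_le_enorm.
have zrho : `|z| <= rho by apply: le_trans zn _; apply: ltW; apply: lt_trans zr _; lra.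
pose e6 := e / 6.
have e60 : 0 < e6 by rewrite divr_gt0.
pose om := e6 / T.
have om0 : 0 < om by rewrite divr_gt0.
have [d d0 Hd] := lagrangian_modulus L_C2 r om0.
(* At speed at most [Vb] a step of duration [dl] moves less than [d], so L varies by less than [om]
   along it. *)
pose dl := Num.min T (d / (Vb + 1)).
have Vb1 : 0 < Vb + 1 by rewrite addr_gt0.
have dl0 : 0 < dl by rewrite lt_min T0 divr_gt0.
have dlT : dl <= T by rewrite ge_min lexx.
have dld : dl * Vb < d.
  have H : dl <= d / (Vb + 1) by rewrite ge_min lexx orbT.
  apply: le_lt_trans (_ : d / (Vb + 1) * Vb < d); first by rewrite ler_wpM2r// ltW.
  by rewrite mulrAC ltr_pdivrMr// ltr_pM2l// ltrDl.
have far y : boundary Omega y -> 2 * K * T < `|x - y|.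
  move=> by_; rewrite -(ltr_pM2l m0).
  apply: lt_le_trans (inner_boundary_dist xin by_).
  move: TE; lra.
have [i0 [N [p [q [tau [cost [i0N Hch pN]]]]]]] :=
  chain x T dl e6 (subset_closure Ox) T0 dl0 dlT e60 far.
set S := fun k => \sum_(i0 <= i < k) tau i.
move=> /andP[TS ST] Uc.
have S0 : 0 < S N by exact: lt_le_trans TS.
have tau0 i : (i0 <= i < N)%N -> 0 < tau i by move=> /Hch[/andP[]].
have Sle k : (i0 <= k <= N)%N -> 0 <= S k /\ S k + \sum_(k <= i < N) tau i = S N.
  move=> /andP[ik kN]; split; last by rewrite /S [RHS](big_cat_nat ik kN).
  rewrite /S big_nat; apply: sumr_ge0 => i /andP[h1 h2].
  by rewrite ltW// tau0// h1 (leq_trans h2).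
have rem_ge0 k : (i0 <= k)%N -> 0 <= \sum_(k <= i < N) tau i.
  move=> ik; rewrite big_nat; apply: sumr_ge0 => i /andP[h1 h2].
  by rewrite ltW// tau0// h2 (leq_trans ik).
have Sinv : (S N)^-1 <= T^-1 by rewrite lef_pV2.
have Sinv0 : 0 < (S N)^-1 by rewrite invr_gt0.
have lam i : (i0 <= i < N)%N -> [/\ 0 <= S i, S i + tau i <= S N &
    `|p i - x| <= K * (2 * T)].
  move=> iN; have /andP[h1 h2] := iN.
  have [a1 _] := Sle i (introT andP (conj h1 (ltnW h2))).
  have iN1 : (i0 <= i.+1 <= N)%N by rewrite (leqW h1).
  have [_ a2] := Sle i.+1 iN1.
  have SS : S i.+1 = S i + tau i by rewrite /S big_nat_recr.
  split => //.
    by rewrite -a2 SS lerDl rem_ge0// leqW.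
  rewrite distrC -pN.
  apply: le_trans (@chain_dist _ _ p q tau i N (ltnW h2) _ _ K _) _.
  - by move=> j /andP[j1 j2]; apply: tau0; rewrite (leq_trans h1).
  - by move=> j /andP[j1 j2]; case: (Hch j); rewrite ?(leq_trans h1).
  - by move=> j /andP[j1 j2]; case: (Hch j); rewrite ?(leq_trans h1).
  apply: ler_wpM2l; first exact: ltW.
  apply: le_trans ST.
  have [_ SE] := Sle i (introT andP (conj h1 (ltnW h2))).
  by rewrite -/(S N) -SE lerDr.
have wE w : w = z \/ w = - z -> enorm w < rho / 8 /\ `|w| <= rho.
  by case=> ->; rewrite ?enormN ?normrN.
have step i w s : (i0 <= i < N)%N -> w = z \/ w = - z -> 0 <= s <= tau i ->
    Omega (p i + (S i / S N) *: w + s *: (q i + (S N)^-1 *: w)).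
  move=> iN wz /andP[s0 st].
  have [/andP[t0 td] qK _ _ _] := Hch i iN.
  have [a1 a2 a3] := lam i iN.
  have [w1 w2] := wE w wz.
  (* Inside a step the shift is the fraction [(S i + s) / S N] of [w], a number in [0, 1], so it is
     no longer than [w]. *)
  have -> : p i + (S i / S N) *: w + s *: (q i + (S N)^-1 *: w) =
     x + ((p i - x + s *: q i) + ((S i + s) / S N) *: w).
    rewrite scalerDr scalerA -[s / S N]/(s * _) mulrDl scalerDl !addrA.
    by rewrite [x + p i]addrC addrK [p i + _ + s *: q i]addrAC.
  apply: inner_tube xin rho0 _ _.
    rewrite -TE ler_pM2l//; apply: le_trans (ler_normD _ _) _.
    have : `|s *: q i| <= T * K.
      rewrite normrZ ger0_norm//; apply: ler_pM => //.
      exact: le_trans st (le_trans td dlT).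
    have := mulr_gt0 K0 T0; lra.
  have mu0 : 0 <= (S i + s) / S N.
    by apply: divr_ge0; [exact: addr_ge0|exact: ltW].
  rewrite enormZ ger0_norm//.
  apply: le_lt_trans w1; rewrite ler_piMl ?enorm_ge0//.
  by rewrite ler_pdivrMr// mul1r; apply: le_trans a2; rewrite lerD2l.
have qV i w : (i0 <= i < N)%N -> w = z \/ w = - z -> `|q i + (S N)^-1 *: w| <= Vb.
  move=> iN wz; have [_ qK _ _ _] := Hch i iN.
  have [_ w2] := wE w wz.
  apply: le_trans (ler_normD _ _) _; apply: lerD => //.
  rewrite normrZ gtr0_norm// mulrC; apply: ler_pM => //; exact: ltW.
have := @chain_perturbation R V U L p q tau cost i0 N i0N tau0 _ z
  (E0 * enorm z ^+ 2) om S0 _ _ _.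
rewrite pN => H.
have {H} H : U (x + z) + U (x - z) <=
   2 * U (p i0) + 2 * \sum_(i0 <= i < N) cost i + S N * (E0 * enorm z ^+ 2 + 2 * om).
  apply: H.
  - by move=> i /Hch[].
  - by move=> i /Hch[].
  - move=> i w iN wz; rewrite -/(S N) -/(S i).
    have ti := tau0 i iN.
    apply: value_step_real => // s s01.
      by apply: subset_closure; exact: step.
    have /andP[s0 st] := s01.
    have vV := qV i w iN wz.
    rewrite -lerBlDl; apply: le_trans (ler_norm _) _; apply: ltW.
    apply: (Hd _ _ _ _ _ _ _).1.
    + apply: le_trans (HRb _ (subset_closure (step i w s iN wz s01))) _.
      by rewrite /r -addrA lerDl addr_ge0// ltW.
    + have := HRb _ (subset_closure (step i w 0 iN wz _)).
      rewrite scale0r addr0 lexx ltW// => /(_ isT) /le_trans; apply.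
      by rewrite /r -addrA lerDl addr_ge0// ltW.
    + by apply: le_trans vV _; rewrite /r lerDr addr_ge0// ltW.
    rewrite addrAC subrr add0r normrZ ger0_norm//.
    apply: le_lt_trans dld; apply: ler_pM => //.
    by have [/andP[_ td] _ _ _ _] := Hch i iN; exact: le_trans td.
  - move=> i iN; rewrite -/(S N) -/(S i).
    have [_ qK _ _ cpi] := Hch i iN.
    have [a1 a2 _] := lam i iN.
    have l01 : 0 <= S i / S N <= 1.
      apply/andP; split; first by apply: divr_ge0 => //; exact: ltW.
      rewrite ler_pdivrMr// mul1r.
      by apply: le_trans a2; rewrite lerDl ltW// tau0.
    have /andP[l0 l1] := l01.
    have az : `|(S i / S N) *: z| <= `|z| by rewrite normrZ ger0_norm// ler_piMl.
    have bz : `|(S N)^-1 *: z| <= T^-1 * `|z| by rewrite normrZ gtr0_norm// ler_wpM2r.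
    apply: le_trans (HC2 _ _ _ _ _ _ _ _) _.
    + by apply: le_trans (HRb _ cpi) _; rewrite /r -addrA lerDl addr_ge0// ltW.
    + apply: le_trans qK _; rewrite /r /Vb.
      have : 0 < rho / T by rewrite divr_gt0.
      lra.
    + by apply: le_trans az _; apply: le_trans zrho _; rewrite /r; lra.
    + apply: le_trans bz _; apply: (@le_trans _ _ (rho / T)).
        by rewrite mulrC ler_wpM2r// invr_ge0 ltW.
      by rewrite /r /Vb; lra.
    rewrite /E0 -mulrA; apply: ler_wpM2l => //.
    have z2 : `|z| ^+ 2 <= enorm z ^+ 2 by rewrite ler_pXn2r ?nnegrE ?enorm_ge0.
    rewrite mulrDl mul1r; apply: lerD.
      by apply: le_trans z2; rewrite ler_pXn2r ?nnegrE.
    have Ti0 : 0 <= T^-1 by rewrite invr_ge0 ltW.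
    rewrite -exprMn ler_pXn2r ?nnegrE//; last by rewrite mulr_ge0// enorm_ge0.
    by apply: le_trans bz _; rewrite ler_wpM2l// invr_ge0 ltW.
have Te : T * om = e6 by rewrite /om mulrC divfK// gt_eqF.
have E0z : 0 <= E0 * enorm z ^+ 2 by rewrite mulr_ge0// sqr_ge0.
have := perturbation_bound_arith T0 TS ST E0z Te e60 H Uc.
by rewrite /e6 [6 * _]mulrC divfK// mulrA.
Qed.

End Semiconcavity.

Unset Implicit Arguments.

Theorem lemma3p9 (R : realType) (n : nat) (Omega : set 'rV[R]_n.+1)
    (L : 'rV[R]_n.+1 -> 'rV[R]_n.+1 -> R) (g : 'rV[R]_n.+1 -> R)
    (Omega_bounded : bounded_set Omega)
    (Omega_lipschitz : lipschitz_domain Omega)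
    (L_tonelli : tonelli L)
    (g_compatible : forall x y : 'rV[R]_n.+1,
      boundary Omega x -> boundary Omega y ->
      ((g x - g y)%R%:E <= potential Omega L y x)%E)
    (c_neg : (critical_value Omega L < 0)%E) :
  let u := value_function Omega L g in
  (forall x : 'rV[R]_n.+1, closure Omega x -> u x \is a fin_num) /\
  forall rho : R, 0 < rho ->
    exists2 C : R, 0 < C &
      forall x z : 'rV[R]_n.+1, inner_region Omega rho x ->
        enorm z < rho / 8 ->
        (u (x + z)%R + u (x - z)%R - 2%:E * u x <=
          (C / rho * enorm z ^+ 2)%R%:E)%E.
Proof.
move=> u.
have [[_ oO _] _] := Omega_lipschitz.
have [c0 c00 Lc0] := tonelli_lower_bound L_tonelli.
have L_cont : continuous (fun p : 'rV[R]_n.+1 * 'rV[R]_n.+1 => L p.1 p.2).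
  by apply: continuous_lagrangian; case: L_tonelli.
have u_fin x : closure Omega x -> u x \is a fin_num.
  exact: (value_fin_num L_cont c00 Lc0 g_compatible Omega_bounded oO).
split => // rho rho0.
have [D D0 HD] := semiconcave_inner L_tonelli oO Omega_bounded u_fin rho0.
(* [D] may depend on [rho] and may be 0; dividing by [rho] gives back [D] plus a positive term. *)
exists (rho * D + 1); first by rewrite ltr_wpDl// mulr_ge0// ltW.
move=> x z xin zr.
have zrho : enorm z < rho by apply: lt_trans zr _; lra.
have cxp : closure Omega (x + z).
  by apply: subset_closure; exact: inner_ball oO xin zrho.
have cxm : closure Omega (x - z).
  by apply: subset_closure; apply: (inner_ball oO xin); rewrite enormN.
have cx : closure Omega x by apply: subset_closure; case: xin.
rewrite -(fineK (u_fin _ cxp)) -(fineK (u_fin _ cxm)) -(fineK (u_fin _ cx)).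
have -> : (2%:E * (fine (u x))%:E)%E = (2 * fine (u x))%:E by rewrite EFinM.
rewrite -EFinN -!EFinD lee_fin.
apply: le_trans (HD x z xin zr) _.
rewrite ler_wpM2r ?sqr_ge0// mulrDl mul1r mulrC mulKf ?gt_eqF//.
by rewrite lerDl invr_ge0 ltW.
Qed.
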